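(* Let $a,b\in\mathbb{C}\setminus\{0\}$, $c>0$, $c>|a|+|b|+2$, and $0<\lambda\le1$. Suppose that $$\frac{\Gamma(c)\,\Gamma(c-|a|-|b|)}{\Gamma(|b|)\,\Gamma(c-|b|)}\Bigg[\frac{(|a|)_2}{(c-|a|-|b|-2)_2}\sum_{n=0}^{\infty}\binom{-(|a|+2)}{n}\frac{\Gamma(|b|+8+2n)}{\Gamma(c-|a|+6+2n)}\;{}_2F_1(|a|+2,|b|+8+2n;c-|a|+6+2n;-1)$$ $$+\frac{(\lambda+2)|a|}{c-|a|-|b|-1}\sum_{n=0}^{\infty}\binom{-(|a|+1)}{n}\frac{\Gamma(|b|+4+2n)}{\Gamma(c-|a|+3+2n)}\;{}_2F_1(|a|+1,|b|+4+2n;c-|a|+3+2n;-1)$$ $$+\lambda\sum_{n=0}^{\infty}\binom{-|a|}{n}\frac{\Gamma(|b|+2n)}{\Gamma(c-|a|+2n)}\;{}_2F_1(|a|,|b|+2n;c-|a|+2n;-1)\Bigg]\le 2\lambda .$$ Then the function $z\;{}_5F_4\left(a,\tfrac{b}{4},\tfrac{b+1}{4},\tfrac{b+2}{4},\tfrac{b+3}{4};\tfrac{c}{4},\tfrac{c+1}{4},\tfrac{c+2}{4},\tfrac{c+3}{4};z\right)$ belongs to the class $\mathcal{C}_\lambda$.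
   Context: $\mathbb{D}=\{z\in\mathbb{C}:|z|<1\}$. $\mathcal{A}$ is the family of functions $f(z)=z+\sum_{n\ge2}a_nz^n$ analytic in $\mathbb{D}$. For $\lambda>0$, $\mathcal{S}^*_\lambda=\{f\in\mathcal{A}:\ |zf'(z)/f(z)-1|<\lambda \text{ for all } z\in\mathbb{D}\}$ and $\mathcal{C}_\lambda=\{f\in\mathcal{A}:\ zf'(z)\in\mathcal{S}^*_\lambda\}$. Pochhammer symbol: $(x)_0=1$, $(x)_n=x(x+1)\cdots(x+n-1)$; generalized binomial coefficient $\binom{-x}{n}=(-1)^n(x)_n/n!$. ${}_5F_4(a_1,\dots,a_5;b_1,\dots,b_4;z)=\sum_{n\ge0}\frac{(a_1)_n\cdots(a_5)_n}{(b_1)_n\cdots(b_4)_n\,(1)_n}z^n$ for $|z|<1$; ${}_2F_1(p,q;r;z)=\sum_{k\ge0}\frac{(p)_k(q)_k}{(r)_k(1)_k}z^k$ for $|z|<1$, extended as usual by analytic continuation to $z=-1$. *)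

(* Defs.v *)
From mathcomp Require Import all_boot all_order all_algebra.
From mathcomp Require Import all_classical all_reals all_analysis.
From mathcomp Require Import complex.

Set Implicit Arguments.
Unset Strict Implicit.
Unset Printing Implicit Defensive.

Import Order.TTheory GRing.Theory Num.Theory.
Import numFieldNormedType.Exports.

Local Open Scope classical_set_scope.
Local Open Scope ring_scope.
Local Open Scope complex_scope.

(* [R[i]^o] is [R[i]] seen as a normed space over itself: it carries the usual
   topology of the complex plane, and derivatives of functions
   [R[i]^o -> R[i]^o] are complex derivatives. Its norm is [R[i]]-valued. *)
Notation cplx R := (R[i]^o)%type.

Definition of_real (R : realType) (x : R) : cplx R := x%:C.

Definition cabs (R : realType) (z : cplx R) : R := complex.Re `|z|.

Definition unit_disc (R : realType) : set (cplx R) := [set z | `|z| < 1].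

Definition holomorphic_on (R : realType) (U : set (cplx R))
    (f : cplx R -> cplx R) : Prop :=
  forall z, U z -> derivable f z 1.

Definition pochhammer (K : pzRingType) (x : K) (n : nat) : K :=
  \prod_(i < n) (x + i%:R).

Definition gbinom (K : fieldType) (y : K) (n : nat) : K :=
  (-1) ^+ n * pochhammer (- y) n / n`!%:R.

(* Euler's integral; meaningful for [0 < x] only. *)
Definition Gamma (R : realType) (x : R) : R :=
  \int[lebesgue_measure]_(t in `]0, +oo[) (t `^ (x - 1) * expR (- t)).

Definition hyp_term (R : realType) (num den : seq (cplx R)) (z : cplx R)
    (n : nat) : cplx R :=
  (\prod_(x <- num) pochhammer x n) /
  ((\prod_(y <- den) pochhammer y n) * pochhammer 1 n) * z ^+ n.

(* Meaningful for [`|z| < 1] only. *)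
Definition hyp5F4 (R : realType) (a1 a2 a3 a4 a5 b1 b2 b3 b4 z : cplx R) :
    cplx R :=
  limn (series (hyp_term [:: a1; a2; a3; a4; a5] [:: b1; b2; b3; b4] z)).

(* [1 <= z] in the partial order of [R[i]] means that [z] is real and at
   least 1. *)
Definition slit_plane (R : realType) : set (cplx R) :=
  [set z | ~~ ((1 : R[i]) <= z)].

(* [w] is the value at [z] of the principal branch of 2F1(p, q; r; _): the
   branch is single-valued on the slit plane, so the value does not depend on
   the domain [U] along which the series is continued. *)
Definition is_hyp2F1 (R : realType) (p q r z w : cplx R) : Prop :=
  exists (U : set (cplx R)) (g : cplx R -> cplx R),
    [/\ open U, connected U, @unit_disc R `<=` U & U `<=` @slit_plane R] /\
    [/\ holomorphic_on U g,
        (forall x, unit_disc x ->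
           series (hyp_term [:: p; q] [:: r] x) @ \oo --> g x),
        U z & g z = w].

Definition hyp2F1 (R : realType) (p q r z : cplx R) : cplx R :=
  xget 0 [set w | is_hyp2F1 p q r z w].

(* For real parameters and [z < 1] the value of 2F1 is real, so taking the real
   part loses nothing. *)
Definition hyp2F1_real (R : realType) (p q r z : R) : R :=
  complex.Re (hyp2F1 (of_real p) (of_real q) (of_real r) (of_real z)).

Definition classA (R : realType) (f : cplx R -> cplx R) : Prop :=
  holomorphic_on (@unit_disc R) f /\
  exists a_ : nat -> cplx R,
    [/\ a_ 0%N = 0, a_ 1%N = 1 &
        forall z, unit_disc z -> series (fun n => a_ n * z ^+ n) @ \oo --> f z].

(* At [z = 0] the quotient [z f'(z) / f z] has a removable singularity with
   value 1, so the inequality holds there and only [z != 0] is constrained.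
   [f z != 0] makes the quotient meaningful. *)
Definition classSstar (R : realType) (lam : R) (f : cplx R -> cplx R) : Prop :=
  classA f /\
  forall z, unit_disc z -> z != 0 ->
    f z != 0 /\ cabs (z * 'D_1 f z / f z - 1) < lam.

Definition classC (R : realType) (lam : R) (f : cplx R -> cplx R) : Prop :=
  classA f /\ classSstar lam (fun z => z * 'D_1 f z).

(* Main.v *)
Require Import Defs.
From mathcomp Require Import all_boot all_order all_algebra.
From mathcomp Require Import all_classical all_reals all_analysis.
From mathcomp Require Import complex measurable_realfun ring lra.
Set Implicit Arguments.
Unset Strict Implicit.
Unset Printing Implicit Defensive.
Import Order.TTheory GRing.Theory Num.Theory.
Import numFieldNormedType.Exports.
Local Open Scope classical_set_scope.
Local Open Scope ring_scope.
Local Open Scope complex_scope.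

(* With alpha_n the coefficients of the 5F4 and A = |a|, B = |b|, one has
   |alpha_n| <= A_n := (A)_n (B)_4n / ((c)_4n n!), and
   sum_n (n + 1) (n + lam) A_n <= 2 lam suffices for membership in C_lam.
   Up to Beta(B, c - B), A_n is the integral of (A)_n / n! * t^(4n) against
   t^(B-1) (1-t)^(c-B-1), so by 1 - t^4 = (1-t) (1+t) (1+t^2) the sum of the
   A_n is at most the integral of
   t^(B-1) (1-t)^(c-A-B-1) (1+t)^(-A) (1+t^2)^(-A);
   the parts weighted by n and n (n - 1) are the same with shifted parameters.
   Expanding (1+t^2)^(-A) and using Euler's integral for 2F1 at -1 turns these
   integrals into the three series of the hypothesis.
   Euler's integral is obtained from an explicit continuation of 2F1 to
   |z + 1| < 2, given by its Taylor series at -1; the value at -1 of any other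
   continuation agrees by continuity alone, since -1 lies on the boundary of the
   unit disc. *)

(** * Gamma and Beta integrals *)

(** The weights of the hypothesis come from (n + 1) (n + lam) = n (n - 1) + (lam + 2) n + lam. The
    factors n and n (n - 1) are absorbed by n (A)_n / n! = A (A + 1)_(n-1) / (n - 1)! and by t^(4n)
    = t^4 t^(4(n-1)), hence the shifts of A by 1 and 2 and of B by 4 and 8. The most singular part
    carries (1-t)^(c-A-B-3), integrable at 1 because c > A + B + 2. The bound is 2 lam, and not lam,
    because the term n = 0 alone contributes lam. Euler's integral is the delicate point; it is
    reached with real integrals and real powers only. The expansions of 2F1 at 0 and at -1 both have
    nonnegative coefficients, and re-expanding partial sums of the second never overshoots the
    first. So the comparison at a complex z of the unit disc reduces to the real point |z|, where
    the difference is at most a remainder of the real binomial series. Integrals over (0, 1) are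
    carried on the ray (0, oo) through t = u / (1 + u): there the Gamma-Beta relation needs only
    Tonelli and dilations. *)

Section GammaBeta.
Context {R : realType}.
Implicit Types (x y k q s t u v : R).
Local Notation mu := (@lebesgue_measure R).
Local Notation D := (`](0:R), +oo[%classic).

Lemma in_rayE x : (x \in D) = (0 < x).
Proof. by apply/idP/idP => [/set_mem|x0]; [|apply/mem_set]; rewrite /= in_itv/= andbT. Qed.

(** Exhausting the open ray by closed rays lets substitution be applied to integrands that blow up
    at 0. The free factor [k] is there so that a dilation maps one exhaustion to another. *)
Lemma integral_ray_cvg k (f : R -> \bar R) : 0 < k ->
  measurable_fun D f -> (forall x, 0 < x -> (0 <= f x)%E) ->
  (\int[mu]_(x in `[(k / n.+1%:R)%R, +oo[) f x)%E @[n --> \oo] -->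
  (\int[mu]_(x in D) f x)%E.
Proof.
move=> k0 mf f0.
have -> : D = \bigcup_n `[k / n.+1%:R, +oo[%classic.
  apply/seteqP; split => [x /=|x [n _] /=]; rewrite !in_itv/= !andbT; last first.
    by apply: lt_le_trans; rewrite divr_gt0.
  move=> x0; exists (Num.truncn (k / x)) => //=; rewrite in_itv/= andbT.
  rewrite ler_pdivrMr// mulrC -ler_pdivrMr//.
  by apply: ltW; apply: truncnS_gt.
apply: ge0_nondecreasing_set_cvg_integral.
- move=> m n mn; apply/subsetPset => x /=; rewrite !in_itv/= !andbT.
  by apply: le_trans; rewrite ler_pM2l// lef_pV2 ?posrE// ler_nat.
- by move=> i.
- move=> i; apply: measurable_funS mf => // x /=; rewrite !in_itv/= !andbT.
  by apply: lt_le_trans; rewrite divr_gt0.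
- move=> i x /=; rewrite in_itv/= andbT => h; apply: f0.
  by apply: lt_le_trans h; rewrite divr_gt0.
Qed.

(** Substitution by [k * x] carries the closed ray from 1/(n+1) to the one from k/(n+1); both sides
    are then limits of equal integrals. *)
Lemma integral_dilation k (f : R -> R) : 0 < k ->
  {in D, continuous f} -> (forall x, 0 < x -> 0 <= f x) ->
  (\int[mu]_(x in D) (f x)%:E = k%:E * \int[mu]_(x in D) (f (k * x))%:E)%E.
Proof.
move=> k0 cf f0.
have mf : measurable_fun D f by apply: open_continuous_measurable_fun.
have kD x : 0 < x -> 0 < k * x by move=> x0; rewrite mulr_gt0.
have cfk : {in D, continuous (fun x => f (k * x))}.
  move=> x; rewrite in_rayE => x0.
  apply: continuous_comp; first exact: mulrl_continuous.
  by apply: cf; rewrite in_rayE kD.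
have mfk : measurable_fun D (fun x => f (k * x)).
  exact: open_continuous_measurable_fun.
rewrite -ge0_integralZl_EFin//; last 3 first.
- by move=> x; rewrite /= in_itv/= andbT => x0; rewrite lee_fin f0// kD.
- exact/measurable_EFinP.
- exact: ltW.
have H1 := @integral_ray_cvg k (EFin \o f) k0.
have H2 := @integral_ray_cvg 1 (fun x => (k%:E * (f (k * x))%:E)%E) ltr01.
apply: (cvg_unique _ (H1 _ _)) => //; first exact/measurable_EFinP.
rewrite /= [X in X @ _ --> _](_ : _ = (fun n : nat =>
  \int[mu]_(x in `[(1 / n.+1%:R)%R, +oo[) (k%:E * (f (k * x))%:E))%E).
  apply: H2.
  - by apply/measurable_EFinP; apply: measurable_funM.
  - by move=> x x0; rewrite mule_ge0// lee_fin ?f0 ?kD// ltW.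
apply/funext => n.
set a : R := 1 / n.+1%:R.
have a0 : 0 < a by rewrite divr_gt0.
have -> : k / n.+1%:R = k * a by rewrite /a mul1r.
have dF x : is_derive x 1 ( *%R k) k.
  by apply: is_derive_eq; rewrite /GRing.scale/= mulr1.
have F' : ( *%R k)^`()%classic = cst k.
  by apply/funext => x; rewrite derive1E; apply: derive_val.
rewrite (@increasing_ge0_integration_by_substitutiony _ ( *%R k) f a).
- apply: eq_integral => x _; rewrite F' /= -EFinM; congr EFin.
  by rewrite mulrC.
- by move=> x y _ _ xy; rewrite ltr_pM2l.
- by rewrite F' => x _; exact: cvg_cst.
- by rewrite F'; exact: is_cvg_cst.
- by rewrite F'; exact: is_cvg_cst.
- split => [x _|]; first by apply: ex_derive.
  by apply: cvg_at_right_filter; exact: mulrl_continuous.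
- by apply: gt0_cvgMry => //; exact: cvg_id.
- apply/continuous_in_subspaceT => x /set_mem; rewrite /= in_itv/= andbT => h.
  by apply: cf; rewrite in_rayE (lt_le_trans _ h)// mulr_gt0.
- move=> x; rewrite in_itv/= andbT => h; apply: f0; apply: lt_trans h.
  by rewrite mulr_gt0.
Qed.

(** Tonelli's theorem on the whole plane, applied to [h] extended by 0 outside the quadrant. *)
Lemma ray_tonelli (h : R * R -> \bar R) :
  measurable_fun [set: R * R] h -> (forall p, (0 <= h p)%E) ->
  (\int[mu]_(x in D) \int[mu]_(y in D) h (x, y) =
   \int[mu]_(y in D) \int[mu]_(x in D) h (x, y))%E.
Proof.
move=> mh h0.
have mDD : measurable (D `*` D) by apply: measurableX.
pose f := h \_ (D `*` D).
have mf : measurable_fun [set: R * R] f.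
  by apply/(measurable_restrictT _ mDD); apply: measurable_funS mh.
have f0 p : (0 <= f p)%E by rewrite /f patchE; case: ifP.
have fE x y : f (x, y) = if (x \in D) && (y \in D) then h (x, y) else 0%E.
  by rewrite /f patchE in_setX.
have := fubini_tonelli (m1 := mu) (m2 := mu) f mf f0.
move=> H; rewrite [LHS]integral_mkcond [RHS]integral_mkcond.
transitivity (\int[mu]_x \int[mu]_y f (x, y))%E.
  apply: eq_integral => x _; rewrite patchE; case: ifPn => xD.
    rewrite integral_mkcond; apply: eq_integral => y _.
    by rewrite patchE fE xD.
  by rewrite integral0_eq// => y _; rewrite fE (negbTE xD).
rewrite H; apply: eq_integral => y _; rewrite patchE; case: ifPn => yD.
  rewrite [RHS]integral_mkcond; apply: eq_integral => x _.
  by rewrite patchE fE yD andbT.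
by rewrite integral0_eq// => x _; rewrite fE (negbTE yD) andbF.
Qed.

Lemma ray_integralZl (k : \bar R) (f : R -> R) : measurable_fun [set: R] f ->
  (forall x, 0 <= f x) -> (0 <= k)%E ->
  (\int[mu]_(x in D) (k * (f x)%:E) = k * \int[mu]_(x in D) (f x)%:E)%E.
Proof.
move=> mf f0 k0; apply: ge0_integralZl => //.
  by apply/measurable_EFinP; apply: measurable_funTS.
by move=> x _; rewrite lee_fin.
Qed.

Definition gamma_weight x s := s `^ (x - 1) * expR (- s).
(** Extended-real values let the identities below be proved before any finiteness is known. *)
Definition eGamma x : \bar R := (\int[mu]_(s in D) (gamma_weight x s)%:E)%E.
(** The density t^(q-1) (1-t)^(s-1) dt on (0, 1) after t = u / (1 + u). *)
Definition beta_weight q s u := u `^ (q - 1) * (1 + u) `^ (- (q + s)).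
Definition eBeta q s : \bar R := (\int[mu]_(u in D) (beta_weight q s u)%:E)%E.

Lemma gamma_weight_ge0 x s : 0 <= gamma_weight x s.
Proof. by rewrite mulr_ge0// ?powR_ge0 ?expR_ge0. Qed.

Lemma beta_weight_ge0 q s u : 0 <= beta_weight q s u.
Proof. by rewrite mulr_ge0// powR_ge0. Qed.

Lemma measurable_powR_expR k p :
  measurable_fun [set: R] (fun s : R => s `^ p * expR (- (k * s))).
Proof.
apply: measurable_funM; first exact: measurable_powR.
apply: (measurableT_comp (@measurable_expR _)).
by apply: measurableT_comp => //; exact: measurable_funM.
Qed.

Lemma measurable_gamma_weight x : measurable_fun [set: R] (gamma_weight x).
Proof.
apply: measurable_funM; first exact: measurable_powR.
by apply: measurableT_comp => //; exact: measurable_expR.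
Qed.

Lemma measurable_beta_weight q s : measurable_fun [set: R] (beta_weight q s).
Proof.
apply: measurable_funM; first exact: measurable_powR.
apply: (measurableT_comp (measurable_powR _)).
exact: measurable_funD.
Qed.

Lemma eGamma_ge0 x : (0 <= eGamma x)%E.
Proof. by apply: integral_ge0 => s _; rewrite lee_fin gamma_weight_ge0. Qed.

Lemma eBeta_ge0 q s : (0 <= eBeta q s)%E.
Proof. by apply: integral_ge0 => u _; rewrite lee_fin beta_weight_ge0. Qed.

Lemma eGamma_scaled k x : 0 < k ->
  (\int[mu]_(s in D) (s `^ (x - 1) * expR (- (k * s)))%:E =
   (k `^ (- x))%:E * eGamma x)%E.
Proof.
move=> k0; rewrite /eGamma (@integral_dilation k (gamma_weight x))//; last 2 first.
- move=> s; rewrite in_rayE => s0; apply: differentiable_continuous.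
  apply/derivable1_diffP/derivableM.
    by apply: derivable_powR; rewrite in_itv/= s0.
  exact: ex_derive.
- by move=> s _; exact: gamma_weight_ge0.
rewrite [X in (_ = _ * (_ * X))%E](_ : _ =
   \int[mu]_(s in D) ((k `^ (x - 1))%:E * (s `^ (x - 1) * expR (- (k * s)))%:E))%E.
  rewrite (ray_integralZl (f := fun s => s `^ (x - 1) * expR (- (k * s)))); first last.
  - by rewrite lee_fin powR_ge0.
  - by move=> s; rewrite mulr_ge0 ?powR_ge0 ?expR_ge0.
  - exact: measurable_powR_expR.
  rewrite !muleA -!EFinM [X in (X%:E * _)%E](_ : _ = 1) ?mul1e//.
  rewrite powRN powRB ?(gt_eqF k0) ?implybT// powRr1 ?(ltW k0)//.
  by field; rewrite !gt_eqF ?powR_gt0.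
apply: eq_integral => s; rewrite in_rayE => s0.
by rewrite /gamma_weight powRM ?(ltW s0) ?(ltW k0)// -EFinM mulrA.
Qed.

(** Both sides are iterated integrals of x^(q+s-1) exp(-(1+y) x) y^(q-1). Integrating in y first
    leaves Gamma(q) times the Gamma weight of [s]; integrating in x first leaves Gamma(q + s) times
    the Beta weight, by the dilation by 1 + y. *)
Lemma eGammaM_eBeta q s : 0 < q -> 0 < s ->
  (eGamma s * eGamma q = eGamma (q + s) * eBeta q s)%E.
Proof.
move=> q0 s0.
pose h (p : R * R) : \bar R :=
  (p.1 `^ (q + s - 1) * expR (- ((1 + p.2) * p.1)) * p.2 `^ (q - 1))%:E.
have h0 p : (0 <= h p)%E by rewrite lee_fin !mulr_ge0// ?powR_ge0 ?expR_ge0.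
have mh : measurable_fun [set: R * R] h.
  apply/measurable_EFinP; apply: measurable_funM; first apply: measurable_funM.
  - by apply: (measurableT_comp (measurable_powR _)).
  - apply: (measurableT_comp (@measurable_expR _)).
    apply: measurableT_comp => //; apply: measurable_funM => //.
    exact: measurable_funD.
  - by apply: (measurableT_comp (measurable_powR _)).
have powR_mul x a b : 0 < x -> x `^ a * x `^ b = x `^ (a + b).
  by move=> x0; rewrite powRD// (gt_eqF x0) implybT.
have H := ray_tonelli mh h0.
transitivity (\int[mu]_(x in D) (eGamma q * (gamma_weight s x)%:E))%E.
  rewrite (ray_integralZl (measurable_gamma_weight s) (@gamma_weight_ge0 s)
    (eGamma_ge0 q)).
  by rewrite -/(eGamma s) [LHS]muleC.
transitivity (\int[mu]_(x in D) \int[mu]_(y in D) h (x, y))%E.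
  apply: eq_integral => x; rewrite in_rayE => x0.
  rewrite (_ : (fun y => h (x, y)) = fun y =>
    ((x `^ (q + s - 1) * expR (- x))%:E * (y `^ (q - 1) * expR (- (x * y)))%:E)%E); last first.
    apply/funext => y; rewrite /h/= -EFinM; congr EFin.
    by rewrite mulrDl mul1r opprD expRD (mulrC x y) -!mulrA (mulrC (y `^ _)).
  rewrite (ray_integralZl (f := fun y => y `^ (q - 1) * expR (- (x * y)))); first last.
  - by rewrite lee_fin mulr_ge0 ?powR_ge0 ?expR_ge0.
  - by move=> y; rewrite mulr_ge0 ?powR_ge0 ?expR_ge0.
  - exact: measurable_powR_expR.
  have E := @eGamma_scaled x q x0.
  rewrite E muleA -EFinM [RHS]muleC; congr (_ * EFin _)%E.
  rewrite [RHS]mulrAC (powR_mul _ _ _ x0) /gamma_weight.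
  by rewrite [q + s]addrC [s + q - 1]addrAC addrK.
transitivity (\int[mu]_(y in D) (eGamma (q + s) * (beta_weight q s y)%:E))%E; last first.
  exact: (ray_integralZl (measurable_beta_weight q s) (@beta_weight_ge0 q s)
    (eGamma_ge0 (q + s))).
rewrite H.
apply: eq_integral => y; rewrite in_rayE => y0.
rewrite (_ : (fun x => h (x, y)) = fun x =>
  ((y `^ (q - 1))%:E * (x `^ (q + s - 1) * expR (- ((1 + y) * x)))%:E)%E); last first.
  by apply/funext => x; rewrite /h/= -EFinM mulrC.
rewrite (ray_integralZl (f := fun x => x `^ (q + s - 1) * expR (- ((1 + y) * x)))); first last.
- by rewrite lee_fin powR_ge0.
- by move=> x; rewrite mulr_ge0 ?powR_ge0 ?expR_ge0.
- exact: measurable_powR_expR.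
have E := @eGamma_scaled (1 + y) (q + s) (addr_gt0 ltr01 y0).
by rewrite E muleA -EFinM [LHS]muleC.
Qed.

Lemma cvg_powRN x : 0 < x -> (1 + u) `^ (- x) @[u --> +oo] --> (0 : R).
Proof.
move=> x0; apply/cvgrPdist_lt => e e0; near=> u.
have u0 : 0 < u by near: u; exact: nbhs_pinfty_gt.
have u1 : e `^ (- x^-1) < 1 + u.
  rewrite -ltrBlDl; near: u; apply: nbhs_pinfty_gt; exact: num_real.
rewrite sub0r normrN ger0_norm ?powR_ge0// powRN invf_plt ?posrE ?powR_gt0 ?addr_gt0//.
have := @gt0_ltr_powR R x x0 (e `^ (- x^-1)) (1 + u).
rewrite !nnegrE powR_ge0 addr_ge0 ?(ltW u0)// => /(_ isT isT u1).
by rewrite -powRrM mulNr mulVf ?gt_eqF// powR_inv1// ltW.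
Unshelve. all: by end_near. Qed.

Lemma eGamma1 : eGamma 1 = 1%E :> \bar R.
Proof.
rewrite -[RHS](@integral_exponential_pdf R 1 ltr01).
transitivity (\int[mu]_(x in `[0%R, +oo[) (1 * expR (- 1 * x))%:E)%E.
  rewrite -integral_itv_obnd_cbnd; last first.
    apply/measurable_EFinP; apply: measurable_funTS.
    apply: measurable_funM => //; apply: (measurableT_comp (@measurable_expR _)).
    exact: measurable_funM.
  apply: eq_integral => s _.
  by rewrite /gamma_weight subrr powRr0 mulN1r.
rewrite [LHS]integral_mkcond; apply: eq_integral => x _.
by rewrite /exponential_pdf !patchE; case: ifP.
Qed.

Lemma eBeta1 x : 0 < x -> eBeta 1 x = (x^-1)%:E.
Proof.
move=> x0; rewrite /eBeta.
have mf : measurable_fun [set: R] (fun u : R => (1 + u) `^ (- (1 + x))).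
  apply: (measurableT_comp (measurable_powR _)); exact: measurable_funD.
transitivity (\int[mu]_(u in `]0%R, +oo[) ((1 + u) `^ (- (1 + x)))%:E)%E.
  by apply: eq_integral => u _; rewrite /beta_weight subrr powRr0 mul1r.
rewrite integral_itv_obnd_cbnd; last first.
  by apply/measurable_EFinP; apply: measurable_funTS.
pose F u := - x^-1 * (1 + u) `^ (- x).
have dF u : 0 <= u -> is_derive u 1 F ((1 + u) `^ (- (1 + x))).
  move=> u0.
  have d1 : is_derive u 1 (fun u => 1 + u) (1 : R).
    rewrite (_ : (fun u => 1 + u) = cst (1 : R) + id)//.
    by apply: is_derive_eq; rewrite add0r.
  have d2 := @is_derive1_powR R (- x) (1 + u) (ltr_pwDl ltr01 u0).
  have d3 := is_derive1_comp d2 d1.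
  have := is_deriveZ (- x^-1) d3.
  rewrite (_ : _ *: _ = (1 + u) `^ (- (1 + x)))//.
  rewrite /GRing.scale/= mulr1 mulrA mulrNN mulVf ?gt_eqF// mul1r.
  by congr (_ `^ _); rewrite opprD addrC.
have cF u : 0 <= u -> {for u, continuous F}.
  move=> u0; apply: differentiable_continuous; apply/derivable1_diffP.
  by have := dF _ u0 => ?; exact: ex_derive.
have cw u : 0 <= u -> {for u, continuous (fun u => (1 + u) `^ (- (1 + x)))}.
  move=> u0; rewrite (_ : (fun u => _) = (@powR R ^~ (- (1 + x))) \o (fun u => 1 + u))//.
  apply: continuous_comp.
    by apply: continuousD; [exact: cvg_cst|exact: cvg_id].
  apply: differentiable_continuous; apply/derivable1_diffP.
  by apply: derivable_powR; rewrite in_itv/= andbT ltr_pwDl.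
rewrite (@ge0_continuous_FTC2y _ _ F 0 0)//.
- by rewrite -EFinB /F addr0 powR1 mulr1 sub0r opprK.
- by move=> u _; exact: powR_ge0.
- apply/continuous_within_itvcyP; split => [u|]; last first.
    by apply: cvg_at_right_filter; apply: cw.
  by rewrite in_itv/= andbT => /ltW; exact: cw.
- rewrite /F -[0 in X in _ --> X](mulr0 (- x^-1)).
  by apply: cvgM; [exact: cvg_cst|exact: cvg_powRN].
- by move=> u u0; have := dF u (ltW u0) => ?; exact: ex_derive.
- by apply: cvg_at_right_filter; apply: cF.
- move=> u; rewrite in_itv/= andbT => u0; rewrite derive1E.
  by have := dF u (ltW u0) => ?; exact: derive_val.
Qed.

(** The functional equation is the case q = 1 of the Gamma-Beta relation, where the Beta integral is
    elementary; this replaces an integration by parts. *)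
Lemma eGammaS x : 0 < x -> eGamma (1 + x) = (x%:E * eGamma x)%E.
Proof.
move=> x0; have E : (eGamma x * eGamma 1 = eGamma (1 + x) * eBeta 1 x)%E.
  exact: eGammaM_eBeta.
rewrite eGamma1 mule1 eBeta1// in E; rewrite E muleCA -EFinM divff ?gt_eqF//.
by rewrite mule1.
Qed.

Lemma eGamma_nat n : (eGamma (n.+1%:R : R) < +oo)%E.
Proof.
elim: n => [|n IH]; first by rewrite eGamma1 ltry.
by rewrite -natr1 addrC eGammaS ?ltr0n// lte_mul_pinfty// ?lee_fin.
Qed.

(** The functional equation reduces to 1 + x, where the exponent is positive; then s^x <= 1 + s^n
    for an integer n > x, and Gamma is finite at positive integers. *)
Lemma eGamma_lty x : 0 < x -> (eGamma x < +oo)%E.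
Proof.
move=> x0; suff : (eGamma (1 + x) < +oo)%E.
  rewrite eGammaS//; case: (eGamma x) (eGamma_ge0 x) => [r||] //.
    by move=> _ _; rewrite ltry.
  by rewrite gt0_muley ?lte_fin.
set n := (Num.truncn x).+1.
have xn : x < n%:R by exact: truncnS_gt.
apply: (@le_lt_trans _ _ (eGamma 1 + eGamma n.+1%:R)%E); last first.
  by apply: lte_add_pinfty; [rewrite eGamma1 ltry|exact: eGamma_nat].
rewrite /eGamma -ge0_integralD//; last 4 first.
- by move=> s _; rewrite lee_fin gamma_weight_ge0.
- by apply/measurable_EFinP; apply: measurable_funTS; exact: measurable_gamma_weight.
- by move=> s _; rewrite lee_fin gamma_weight_ge0.
- by apply/measurable_EFinP; apply: measurable_funTS; exact: measurable_gamma_weight.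
apply: ge0_le_integral => //.
- by move=> s _; rewrite lee_fin gamma_weight_ge0.
- by apply/measurable_EFinP; apply: measurable_funTS; exact: measurable_gamma_weight.
- apply: emeasurable_funD; apply/measurable_EFinP; apply: measurable_funTS;
    exact: measurable_gamma_weight.
move=> s; rewrite /= in_itv/= andbT => s0; rewrite -EFinD lee_fin /gamma_weight.
rewrite -mulrDl ler_wpM2r ?expR_ge0// subrr powRr0 -natr1 addrK [1 + x]addrC addrK.
have [s1|s1] := leP 1 s.
  by apply: (le_trans (ler_powR s1 (ltW xn))); rewrite lerDr.
rewrite (@le_trans _ _ 1)// ?lerDl ?powR_ge0//.
by rewrite -[leRHS](powRr0 s) ger_powR ?s0 ?(ltW s1)// ltW.
Qed.

Lemma eGamma_gt0 x : 0 < x -> (0 < eGamma x)%E.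
Proof.
(* On [1, 2] the weight is at least [c]: s^(x-1) >= s^(-1) >= 1/2 and exp(-s) >= exp(-2). *)
move=> x0; pose c : R := 2^-1 * expR (- 2).
have c0 : 0 < c by rewrite mulr_gt0 ?expR_gt0.
apply: (@lt_le_trans _ _ (\int[mu]_(s in `[1%R, 2%R]) c%:E)%E).
  rewrite integral_cst//= lebesgue_measure_itv/= lte_fin ltr1n/= -EFinD -EFinM lte_fin.
  by rewrite mulr_gt0//; lra.
have sub : `[(1 : R), 2] `<=` D.
  by move=> s; rewrite /= !in_itv/= andbT => /andP[+ _]; exact: lt_le_trans.
apply: (@le_trans _ _ (\int[mu]_(s in `[1%R, 2%R]) (gamma_weight x s)%:E)%E).
  apply: ge0_le_integral => //.
  - by move=> s _; rewrite lee_fin ltW.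
  - by apply/measurable_EFinP; apply: measurable_funTS; exact: measurable_gamma_weight.
  move=> s; rewrite /= in_itv/= => /andP[s1 s2]; rewrite lee_fin /gamma_weight.
  have s0 : 0 < s by exact: lt_le_trans s1.
  have h : 2^-1 <= s `^ (x - 1).
    apply: (@le_trans _ _ (s `^ (- 1))).
      by rewrite powR_inv1 ?(ltW s0)// lef_pV2 ?posrE//.
    by apply: ler_powR => //; lra.
  by apply: ler_pM; rewrite ?invr_ge0 ?expR_ge0// ler_expR lerN2.
apply: ge0_subset_integral => //.
- by apply/measurable_EFinP; apply: measurable_funTS; exact: measurable_gamma_weight.
- by move=> s _; rewrite lee_fin gamma_weight_ge0.
Qed.

Lemma eGammaE x : 0 < x -> eGamma x = (Gamma x)%:E.
Proof.
move=> x0; rewrite /Gamma /Rintegral fineK//.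
by rewrite ge0_fin_numE ?eGamma_ge0// eGamma_lty.
Qed.

Lemma Gamma_gt0 x : 0 < x -> 0 < Gamma x.
Proof. by move=> x0; rewrite -lte_fin -eGammaE// eGamma_gt0. Qed.

Lemma GammaS x : 0 < x -> Gamma (1 + x) = x * Gamma x.
Proof.
move=> x0; apply: EFin_inj; rewrite EFinM -!eGammaE ?addr_gt0//.
exact: eGammaS.
Qed.

Lemma eBetaE q s : 0 < q -> 0 < s ->
  eBeta q s = (Gamma q * Gamma s / Gamma (q + s))%:E.
Proof.
move=> q0 s0; have := eGammaM_eBeta q0 s0.
have qs0 := addr_gt0 q0 s0.
rewrite !eGammaE// => E.
(* An infinite Beta integral, multiplied by Gamma(q + s) > 0, would contradict the finite left side
   of [E]. *)
have : eBeta q s \is a fin_num.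
  rewrite ge0_fin_numE ?eBeta_ge0//; have := eBeta_ge0 q s; move: E.
  case: (eBeta q s) => [r||]//; first by rewrite ltry.
  by rewrite mulry gtr0_sg ?Gamma_gt0// mul1e.
move: E; case: (eBeta q s) => // r; rewrite -!EFinM => -[E] _; congr EFin.
by rewrite [Gamma q * _]mulrC E mulrC mulKf// gt_eqF// Gamma_gt0.
Qed.
End GammaBeta.

(** * Integration of bounded functions against a Beta weight *)

Section BetaIntegral.
Context {R : realType}.
Implicit Types (h : R -> R) (p q s t u M : R).
Local Notation mu := (@lebesgue_measure R).
Local Notation D := (`](0:R), +oo[%classic).

(** In the variable t = u / (1 + u) this is the integral over (0, 1) of t^(q-1) (1-t)^(s-1) h(t),
    not normalised. *)
Definition beta_integral q s h : R :=
  \int[mu]_(u in D) (beta_weight q s u * h (u / (1 + u))).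

(** A bound on (0, 1) is enough, since u / (1 + u) stays there; it makes every integrand dominated
    by a multiple of the Beta weight. *)
Definition tame h := measurable_fun [set: R] h /\
  exists M, forall t, 0 < t < 1 -> `|h t| <= M.

Lemma ray_unit u : 0 < u -> 0 < u / (1 + u) < 1.
Proof.
move=> u0; have u1 : 0 < 1 + u by rewrite addr_gt0.
by rewrite divr_gt0//= ltr_pdivrMr// mul1r ltrDr.
Qed.

Lemma tame_integrable q s h : 0 < q -> 0 < s -> tame h ->
  mu.-integrable D (EFin \o (fun u => beta_weight q s u * h (u / (1 + u)))).
Proof.
move=> q0 s0 [mh [M hM]].
have mt : measurable_fun D (fun u : R => u / (1 + u)).
  apply: open_continuous_measurable_fun => //= u; rewrite in_rayE => u0.
  apply: cvgM; first exact: cvg_id.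
  apply: cvgV; first by rewrite gt_eqF// addr_gt0.
  by apply: cvgD; [exact: cvg_cst|exact: cvg_id].
have mw := @measurable_beta_weight R q s.
have M0 : 0 <= M by apply: le_trans (hM 2^-1 _) => //; lra.
have iw : mu.-integrable D (fun u => M%:E * (beta_weight q s u)%:E)%E.
  apply: integrableZl => //; apply/integrableP; split.
    by apply/measurable_EFinP; exact: measurable_funTS.
  rewrite (_ : integral _ _ _ = eBeta q s); first by rewrite eBetaE// ltry.
  by apply: eq_integral => u _; rewrite gee0_abs// lee_fin beta_weight_ge0.
apply: le_integrable iw => //.
- apply/measurable_EFinP; apply: measurable_funM.
    exact: measurable_funTS.
  exact: measurableT_comp mt.
- move=> u /=; rewrite in_itv/= andbT => u0; rewrite lee_fin.
  rewrite normrM [leRHS]ger0_norm ?(mulr_ge0 M0 (beta_weight_ge0 _ _ _))//.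
  rewrite ger0_norm ?beta_weight_ge0// mulrC.
  by rewrite ler_wpM2r ?beta_weight_ge0// hM// ray_unit.
Qed.

Lemma eq_beta_integral q s h1 h2 : (forall t, 0 < t < 1 -> h1 t = h2 t) ->
  beta_integral q s h1 = beta_integral q s h2.
Proof.
move=> E; apply: eq_Rintegral => u; rewrite in_rayE => u0.
by rewrite E// ray_unit.
Qed.

Lemma le_beta_integral q s h1 h2 : 0 < q -> 0 < s -> tame h1 -> tame h2 ->
  (forall t, 0 < t < 1 -> h1 t <= h2 t) ->
  beta_integral q s h1 <= beta_integral q s h2.
Proof.
move=> q0 s0 t1 t2 E; apply: le_Rintegral => //; try exact: tame_integrable.
move=> u; rewrite /= in_itv/= andbT => u0.
by rewrite ler_wpM2l ?beta_weight_ge0// E// ray_unit.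
Qed.

Lemma beta_integralD q s h1 h2 : 0 < q -> 0 < s -> tame h1 -> tame h2 ->
  beta_integral q s (fun t => h1 t + h2 t) =
  beta_integral q s h1 + beta_integral q s h2.
Proof.
move=> q0 s0 t1 t2; rewrite -RintegralD//; try exact: tame_integrable.
by apply: eq_Rintegral => u _; rewrite mulrDr.
Qed.

Lemma beta_integralZ q s k h : 0 < q -> 0 < s -> tame h ->
  beta_integral q s (fun t => k * h t) = k * beta_integral q s h.
Proof.
move=> q0 s0 th; rewrite -RintegralZl//; last exact: tame_integrable.
by apply: eq_Rintegral => u _; rewrite mulrCA.
Qed.

Lemma tame_cst k : tame (fun=> k).
Proof. by split; [exact: measurable_cst|exists `|k|]. Qed.

Lemma tameD h1 h2 : tame h1 -> tame h2 -> tame (fun t => h1 t + h2 t).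
Proof.
move=> [m1 [M1 b1]] [m2 [M2 b2]]; split; first exact: measurable_funD.
exists (M1 + M2) => t t01; rewrite (le_trans (ler_normD _ _))//.
by rewrite lerD ?b1 ?b2.
Qed.

Lemma tameM h1 h2 : tame h1 -> tame h2 -> tame (fun t => h1 t * h2 t).
Proof.
move=> [m1 [M1 b1]] [m2 [M2 b2]]; split; first exact: measurable_funM.
by exists (M1 * M2) => t t01; rewrite normrM ler_pM ?b1 ?b2.
Qed.

Lemma tameZ k h : tame h -> tame (fun t => k * h t).
Proof. by move=> th; apply: tameM => //; exact: tame_cst. Qed.

Lemma tame_id : tame id.
Proof.
by split=> //; exists 1 => t /andP[t0 t1]; rewrite gtr0_norm// ltW.
Qed.

Lemma tameX h k : tame h -> tame (fun t => h t ^+ k).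
Proof.
move=> th; elim: k => [|k IH]; first exact: tame_cst.
by under eq_fun do rewrite exprS; exact: tameM.
Qed.

Lemma tame_sum N (h : nat -> R -> R) : (forall k, tame (h k)) ->
  tame (fun t => \sum_(k < N) h k t).
Proof.
move=> th; elim: N => [|N IH].
  by under eq_fun do rewrite big_ord0; exact: tame_cst.
by under eq_fun do rewrite big_ord_recr/=; exact: tameD.
Qed.

Lemma tame_powRN h p : 0 <= p -> measurable_fun [set: R] h ->
  (forall t, 0 < t < 1 -> 1 <= h t) -> tame (fun t => h t `^ (- p)).
Proof.
move=> p0 mh h1; split; first exact: (measurableT_comp (measurable_powR _)).
exists 1 => t /h1 ht; rewrite ger0_norm ?powR_ge0//.
by rewrite -[leRHS](powRr0 (h t)) ler_powR// oppr_le0.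
Qed.

Lemma beta_integral_sum q s N (h : nat -> R -> R) : 0 < q -> 0 < s ->
  (forall k, tame (h k)) ->
  beta_integral q s (fun t => \sum_(k < N) h k t) =
  \sum_(k < N) beta_integral q s (h k).
Proof.
move=> q0 s0 th; elim: N => [|N IH].
  rewrite big_ord0 (@eq_beta_integral _ _ _ (fun=> 0 * 1)); last first.
    by move=> t _; rewrite big_ord0 mul0r.
  by rewrite (beta_integralZ _ q0 s0 (tame_cst 1)) mul0r.
rewrite big_ord_recr/= -IH -beta_integralD//; last exact: tame_sum.
by apply: eq_beta_integral => t _; rewrite big_ord_recr.
Qed.

Lemma beta_integral1 q s : 0 < q -> 0 < s ->
  beta_integral q s (fun=> 1) = Gamma q * Gamma s / Gamma (q + s).
Proof.
move=> q0 s0; apply: EFin_inj; rewrite -eBetaE// /beta_integral /Rintegral.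
under eq_integral do rewrite mulr1.
by rewrite fineK// -/(eBeta q s) eBetaE.
Qed.

(** A factor t^k = u^k / (1 + u)^k merges into the weight and raises its first parameter. *)
Lemma beta_integralX q s k h :
  beta_integral q s (fun t => t ^+ k * h t) = beta_integral (q + k%:R) s h.
Proof.
apply: eq_Rintegral => u; rewrite in_rayE => u0; rewrite mulrA; congr (_ * _).
have u1 : 0 < 1 + u by rewrite addr_gt0.
rewrite /beta_weight expr_div_n -!powR_mulrn ?(ltW u0) ?(ltW u1)//.
have E1 : u `^ (q + k%:R - 1) = u `^ (q - 1) * u `^ k%:R.
  by rewrite -powRD ?(gt_eqF u0) ?implybT// addrAC.
have E2 : (1 + u) `^ (- (q + k%:R + s)) = (1 + u) `^ (- (q + s)) / (1 + u) `^ k%:R.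
  by rewrite -powRB ?(gt_eqF u1) ?implybT// -opprD addrAC.
by rewrite E1 E2 mulrACA.
Qed.

(** Since 1 - t = 1 / (1 + u), the second parameter of the weight trades against a power of 1 -
    t. *)
Lemma beta_integral_compl q s p h :
  beta_integral q (s + p) h = beta_integral q s (fun t => (1 - t) `^ p * h t).
Proof.
apply: eq_Rintegral => u; rewrite in_rayE => u0; rewrite mulrA; congr (_ * _).
have u1 : 0 < 1 + u by rewrite addr_gt0.
rewrite /beta_weight -mulrA; congr (_ * _).
have -> : 1 - u / (1 + u) = (1 + u) `^ (-1).
  by rewrite powR_inv1 ?(ltW u1)//; field; rewrite gt_eqF.
rewrite -powRrM mulN1r -powRD ?(gt_eqF u1) ?implybT//.
by congr (_ `^ _); rewrite addrA opprD.
Qed.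
End BetaIntegral.

(** * Pochhammer symbols and the binomial series *)

Section Pochhammer.
Context {K : pzRingType}.
Implicit Types x : K.

Lemma pochhammer0 x : pochhammer x 0 = 1.
Proof. by rewrite /pochhammer big_ord0. Qed.

Lemma pochhammerSr x n : pochhammer x n.+1 = pochhammer x n * (x + n%:R).
Proof. by rewrite /pochhammer big_ord_recr. Qed.

Lemma pochhammerD x m n :
  pochhammer x (m + n) = pochhammer x m * pochhammer (x + m%:R) n.
Proof.
elim: n => [|n IH]; first by rewrite addn0 pochhammer0 mulr1.
by rewrite addnS !pochhammerSr IH -mulrA natrD addrA.
Qed.

Lemma pochhammerSl x n : pochhammer x n.+1 = x * pochhammer (x + 1) n.
Proof. by rewrite -[n.+1]add1n pochhammerD pochhammerSr pochhammer0 mul1r addr0. Qed.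
End Pochhammer.

Lemma pochhammer1 (K : pzRingType) n : pochhammer (1 : K) n = n`!%:R.
Proof.
elim: n => [|n IH]; first by rewrite pochhammer0.
by rewrite pochhammerSr IH nat1r -natrM factS mulnC.
Qed.

Section BinomialSeries.
Context {R : realType}.
Implicit Types (p q s t x y : R).

Lemma pochhammer_ge0 x n : 0 <= x -> 0 <= pochhammer x n.
Proof. by move=> x0; apply: prodr_ge0 => i _; rewrite addr_ge0. Qed.

Lemma pochhammer_gt0 x n : 0 < x -> 0 < pochhammer x n.
Proof. by move=> x0; apply: prodr_gt0 => i _; rewrite ltr_pwDl. Qed.

(** Coefficient of y^k in (1 - y)^(-p). The sign convention makes it nonnegative for p >= 0, which
    all later comparisons use. *)
Definition binom_coef p k : R := pochhammer p k / k`!%:R.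

Lemma binom_coef_ge0 p k : 0 <= p -> 0 <= binom_coef p k.
Proof. by move=> p0; rewrite divr_ge0// pochhammer_ge0. Qed.

(** Coefficient form of the derivative rule for (1 - y)^(-p). The same identity later absorbs the
    weights n and n (n - 1). *)
Lemma binom_coefS p k :
  k.+1%:R * binom_coef p k.+1 = p * binom_coef (p + 1) k.
Proof.
rewrite /binom_coef pochhammerSl factS natrM invfM mulrCA.
by rewrite [k.+1%:R * _]mulVKf ?pnatr_eq0// mulrA.
Qed.

(** Differentiation sends the remainder of order N + 1 at [p] to [p] times the remainder of order N
    at [p + 1]. With the value 0 at y = 0 for positive orders, the mean value theorem turns this
    into inductions on N. *)
Definition binom_rem N p y : R :=
  (1 - y) `^ (- p) - \sum_(k < N) binom_coef p k * y ^+ k.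

Lemma binom_remS0 N p : binom_rem N.+1 p 0 = 0.
Proof.
rewrite /binom_rem subr0 powR1 big_ord_recl expr0 mulr1 /binom_coef.
rewrite pochhammer0 fact0 divr1 big1 ?addr0 ?subrr// => i _.
by rewrite exprS mul0r mulr0.
Qed.

Lemma is_derive_binom_rem N p y : y < 1 ->
  is_derive y 1 (binom_rem N.+1 p) (p * binom_rem N (p + 1) y).
Proof.
move=> y1.
have dp : is_derive y 1 (fun y => (1 - y) `^ (- p)) (p * (1 - y) `^ (- (p + 1))).
  have d1 : is_derive y 1 (fun y => 1 - y) (-1 : R).
    rewrite (_ : (fun y => 1 - y) = cst (1 : R) - id)//.
    by apply: is_derive_eq; rewrite sub0r.
  have y10 : 0 < 1 - y by rewrite subr_gt0.
  have := @is_derive1_comp R (@powR R ^~ (- p)) (fun y => 1 - y) y _ _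
    (@is_derive1_powR R (- p) (1 - y) y10) d1.
  rewrite (_ : _ * -1 = p * (1 - y) `^ (- (p + 1)))//.
  by rewrite mulrN1 mulNr opprK opprD.
have ds : is_derive y 1 (fun y => \sum_(k < N.+1) binom_coef p k * y ^+ k)
    (\sum_(k < N) p * (binom_coef (p + 1) k * y ^+ k)).
  elim: N => [|N IH].
    rewrite (_ : (fun y => _) = cst (binom_coef p 0)).
      by rewrite big_ord0; exact: is_derive_cst.
    by apply/funext => x; rewrite big_ord1 expr0 mulr1.
  rewrite (_ : (fun y => _) = (fun y => \sum_(k < N.+1) binom_coef p k * y ^+ k)
    + (binom_coef p N.+1 \*: (fun y => y ^+ N.+1))).
    rewrite big_ord_recr/=; apply: is_deriveD.
    have := is_deriveZ (binom_coef p N.+1) (is_deriveX N.+1 (is_derive_id y (1:R))).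
    rewrite exprfctE (_ : _ *: _ = p * (binom_coef (p + 1) N * y ^+ N))//.
    by rewrite /GRing.scale/= mulr1 [RHS]mulrA -binom_coefS mulrCA mulrA.
  by apply/funext => x; rewrite big_ord_recr.
have := is_deriveB dp ds.
by rewrite -mulr_sumr -mulrBr.
Qed.

Lemma continuous_binom_rem N p y : y < 1 -> {for y, continuous (binom_rem N.+1 p)}.
Proof.
move=> y1; apply: differentiable_continuous; apply/derivable1_diffP.
by have := is_derive_binom_rem N p y1 => ?; exact: ex_derive.
Qed.

Lemma binom_rem_mvt N p y : y < 1 -> exists2 x,
  (0 <= x <= y) || (y <= x <= 0) & binom_rem N.+1 p y = p * binom_rem N (p + 1) x * y.
Proof.
move=> y1.
have [y0|y0] := leP 0 y.
  have [||x] := @MVT_segment R (binom_rem N.+1 p)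
      (fun x => p * binom_rem N (p + 1) x) 0 y y0.
  - move=> x; rewrite in_itv/= => /andP[_ xy].
    by apply: is_derive_binom_rem; exact: lt_trans y1.
  - apply/continuous_in_subspaceT => x /set_mem; rewrite /= in_itv/= => /andP[_ xy].
    by apply: continuous_binom_rem; exact: le_lt_trans y1.
  rewrite in_itv/= binom_remS0 !subr0 => xy E.
  by exists x => //; rewrite xy.
have [||x] := @MVT_segment R (binom_rem N.+1 p)
    (fun x => p * binom_rem N (p + 1) x) y 0 (ltW y0).
- move=> x; rewrite in_itv/= => /andP[_ x0].
  by apply: is_derive_binom_rem; exact: lt_trans ltr01.
- apply/continuous_in_subspaceT => x /set_mem; rewrite /= in_itv/= => /andP[_ x0].
  by apply: continuous_binom_rem; exact: le_lt_trans ltr01.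
rewrite in_itv/= binom_remS0 !sub0r mulrN => xy /oppr_inj E.
by exists x => //; rewrite xy orbT.
Qed.

Lemma binom_rem_ge0 N p y : 0 <= p -> 0 <= y < 1 -> 0 <= binom_rem N p y.
Proof.
elim: N p y => [|N IH] p y p0 /andP[y0 y1].
  by rewrite /binom_rem big_ord0 subr0 powR_ge0.
have [x xy ->] := @binom_rem_mvt N p y y1.
have x0 : 0 <= x <= y.
  case/orP: xy => // /andP[yx x0]; rewrite (le_trans y0 yx)/=.
  exact: le_trans y0.
case/andP: x0 => x0 xy'.
by rewrite !mulr_ge0// IH ?addr_ge0// x0 (le_lt_trans xy').
Qed.

(** Each application of the mean value theorem contributes one factor y <= 0, so the sign alternates
    with N. *)
Lemma binom_rem_sign N p y : 0 <= p -> y <= 0 -> 0 <= (-1) ^+ N * binom_rem N p y.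
Proof.
elim: N p y => [|N IH] p y p0 y0.
  by rewrite /binom_rem big_ord0 subr0 expr0 mul1r powR_ge0.
have [x xy ->] := @binom_rem_mvt N p y (le_lt_trans y0 ltr01).
have x0 : x <= 0.
  by case/orP: xy => /andP[// x0 xy]; exact: le_trans y0.
rewrite exprS [X in 0 <= X](_ : _ = p * ((-1) ^+ N * binom_rem N (p + 1) x) * - y).
  rewrite mulr_ge0 ?oppr_ge0//; apply: mulr_ge0 => //; apply: IH => //.
  exact: addr_ge0.
by ring.
Qed.

Lemma le_binom_rem N p x y : 0 <= p -> 0 <= x -> x <= y -> y < 1 ->
  binom_rem N p x <= binom_rem N p y.
Proof.
move=> p0 x0 xy y1; case: N => [|N].
  rewrite /binom_rem !big_ord0 !subr0 !powRN lef_pV2 ?posrE ?powR_gt0 ?subr_gt0//; last first.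
    exact: le_lt_trans y1.
  apply: ge0_ler_powR; rewrite ?nnegrE ?subr_ge0 ?lerD2l ?lerN2// ltW//.
  exact: le_lt_trans y1.
have [||z] := @MVT_segment R (binom_rem N.+1 p)
    (fun x => p * binom_rem N (p + 1) x) x y xy.
- move=> z; rewrite in_itv/= => /andP[_ zy].
  by apply: is_derive_binom_rem; exact: lt_trans y1.
- apply/continuous_in_subspaceT => z /set_mem; rewrite /= in_itv/= => /andP[_ zy].
  by apply: continuous_binom_rem; exact: le_lt_trans y1.
rewrite in_itv/= => /andP[xz zy] E.
rewrite -subr_ge0 E; apply: mulr_ge0; last by rewrite subr_ge0.
apply: mulr_ge0 => //; apply: binom_rem_ge0; first exact: addr_ge0.
by rewrite (le_trans x0 xz) (le_lt_trans zy).
Qed.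

(** The remainder should behave like y^N times a series with nonnegative coefficients. The
    difference [F] of the two sides vanishes at 0, and the induction hypothesis makes its derivative
    nonnegative. *)
Lemma binom_rem_scale N p k y : 0 <= p -> 0 <= k <= 1 -> 0 <= y < 1 ->
  binom_rem N p (k * y) <= k ^+ N * binom_rem N p y.
Proof.
move=> + /andP[k0 k1]; elim: N p y => [|N IH] p y p0 /andP[y0 y1].
  by rewrite mul1r le_binom_rem ?mulr_ge0// ler_piMl.
pose F x := k ^+ N.+1 * binom_rem N.+1 p x - binom_rem N.+1 p (k * x).
have kx x : 0 <= x < 1 -> k * x < 1.
  by move=> /andP[x0 x1]; apply: le_lt_trans x1; rewrite ler_piMl.
have dF x : 0 <= x < 1 -> is_derive x 1 F (k ^+ N.+1 * (p * binom_rem N (p + 1) x)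
    - p * binom_rem N (p + 1) (k * x) * k).
  move=> x01; have /andP[x0 x1] := x01.
  apply: is_deriveB.
    exact: (is_deriveZ (k ^+ N.+1) (is_derive_binom_rem N p x1)).
  have dk : is_derive x 1 ( *%R k) k by apply: is_derive_eq; rewrite /GRing.scale/= mulr1.
  exact: (is_derive1_comp (is_derive_binom_rem N p (kx _ x01)) dk).
have [||z] := @MVT_segment R F (fun x => k ^+ N.+1 * (p * binom_rem N (p + 1) x)
    - p * binom_rem N (p + 1) (k * x) * k) 0 y y0.
- move=> x; rewrite in_itv/= => /andP[/ltW x0 xy].
  by apply: dF; rewrite x0 (lt_trans xy).
- apply/continuous_in_subspaceT => z /set_mem; rewrite /= in_itv/= => /andP[z0 zy].
  apply: differentiable_continuous; apply/derivable1_diffP.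
  have /dF ? : 0 <= z < 1 by rewrite z0 (le_lt_trans zy).
  exact: ex_derive.
rewrite in_itv/= => /andP[z0 zy].
rewrite {2}/F mulr0 binom_remS0 mulr0 subrr !subr0 => E.
rewrite -subr_ge0 -/(F y) E mulr_ge0//.
rewrite [X in 0 <= X](_ : _ = k * p * (k ^+ N * binom_rem N (p + 1) z
  - binom_rem N (p + 1) (k * z))); last by rewrite exprS; ring.
apply: mulr_ge0; first exact: mulr_ge0.
by rewrite subr_ge0; apply: IH; [exact: addr_ge0|rewrite z0 (le_lt_trans zy)].
Qed.

(** For k strictly between y and 1, the remainder at y = k (y / k) is at most k^N times the
    remainder at y / k, itself at most (1 - y / k)^(-p). *)
Lemma cvg_binom_rem p y : 0 <= p -> 0 <= y < 1 ->
  binom_rem N p y @[N --> \oo] --> (0 : R).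
Proof.
move=> p0 /andP[y0 y1]; pose k := (1 + y) / 2.
have [k0 k1 yk] : [/\ 0 < k, k < 1 & y < k] by rewrite /k; split; lra.
have yk1 : 0 <= y / k < 1 by rewrite divr_ge0 ?(ltW k0)//= ltr_pdivrMr// mul1r.
apply: (@squeeze_cvgr _ _ _ _ (fun=> 0) (fun N => k ^+ N * (1 - y / k) `^ (- p))).
- near=> N; rewrite binom_rem_ge0 ?y0//=.
  rewrite -[y in leLHS](@divfK _ k) ?gt_eqF// mulrC.
  rewrite (le_trans (binom_rem_scale _ p0 _ yk1)) ?(ltW k0) ?(ltW k1)//.
  rewrite ler_wpM2l ?exprn_ge0 ?(ltW k0)// /binom_rem gerBl.
  by apply: sumr_ge0 => i _; rewrite mulr_ge0 ?binom_coef_ge0// exprn_ge0//; case/andP: yk1.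
- exact: cvg_cst.
- rewrite -[0 in X in _ --> X](mul0r ((1 - y / k) `^ (- p))).
  apply: cvgM; last exact: cvg_cst.
  by apply: cvg_expr; rewrite gtr0_norm.
Unshelve. all: by end_near. Qed.

End BinomialSeries.

(** * Complex power series *)

Section ComplexSeries.
Context {R : realType}.
Implicit Types (z w h : cplx R) (r x y : R).

Lemma norm_cabs z : `|z| = (cabs z)%:C.
Proof. by rewrite /cabs RRe_real// normr_real. Qed.

Lemma cabsE z : cabs z = Normc.normc z.
Proof. by case: z. Qed.

Lemma cabs_ge0 z : 0 <= cabs z.
Proof. by rewrite -ler0c -norm_cabs. Qed.

Lemma cabsM z w : cabs (z * w) = cabs z * cabs w.
Proof. by apply: complexI; rewrite rmorphM -!norm_cabs normrM. Qed.

Lemma cabsX z n : cabs (z ^+ n) = cabs z ^+ n.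
Proof. by apply: complexI; rewrite rmorphXn -!norm_cabs normrX. Qed.

Lemma cabsV z : cabs z^-1 = (cabs z)^-1.
Proof. by apply: complexI; rewrite fmorphV -!norm_cabs normfV. Qed.

Lemma cabsN z : cabs (- z) = cabs z.
Proof. by apply: complexI; rewrite -!norm_cabs normrN. Qed.

Lemma cabs_eq0 z : (cabs z == 0) = (z == 0).
Proof. by rewrite -(normr_eq0 z) norm_cabs -(inj_eq (@complexI R)). Qed.

Lemma cabs0 : cabs (0 : cplx R) = 0.
Proof. by apply/eqP; rewrite cabs_eq0. Qed.

Lemma cabs_gt0 z : (0 < cabs z) = (z != 0).
Proof. by rewrite lt_neqAle cabs_ge0 andbT eq_sym cabs_eq0. Qed.

Lemma cabs_real x : cabs (of_real x) = `|x|.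
Proof. by apply: complexI; rewrite -norm_cabs /of_real normc_def/= expr0n addr0 sqrtr_sqr. Qed.

Lemma cabs_nat n : cabs (n%:R : cplx R) = n%:R.
Proof. by apply: complexI; rewrite -norm_cabs normr_nat rmorph_nat. Qed.

Lemma cabsD z w : cabs (z + w) <= cabs z + cabs w.
Proof. by rewrite -lecR rmorphD -!norm_cabs ler_normD. Qed.

Lemma cabs_dist z w : `|cabs z - cabs w| <= cabs (z - w).
Proof.
have H u v : cabs u - cabs v <= cabs (u - v) :> R.
  by rewrite lerBlDr -{1}(subrK v u) cabsD.
by rewrite ler_norml H andbT lerNl opprB -(cabsN (z - w)) opprB H.
Qed.

Lemma cabs_sum n (F : nat -> cplx R) :
  cabs (\sum_(i < n) F i) <= \sum_(i < n) cabs (F i).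
Proof.
elim: n => [|n IH]; first by rewrite !big_ord0 cabs0.
by rewrite !big_ord_recr/= (le_trans (cabsD _ _))// lerD2r.
Qed.

Lemma cabs_ReIm z : cabs z <= `|complex.Re z| + `|complex.Im z|.
Proof.
rewrite {1}(complexE z) (le_trans (cabsD _ _))// cabsM.
rewrite -[cabs (_%:C)]/(cabs (of_real _)) -[cabs (complex.Im z)%:C]/(cabs (of_real _)).
rewrite !cabs_real lerD2l -[leRHS]mul1r ler_wpM2r//.
by rewrite cabsE/= expr0n expr1n add0r sqrtr1.
Qed.

Lemma cvg_cabsP (T : Type) (F : set_system T) {FF : Filter F} (f : T -> cplx R) z :
  f x @[x --> F] --> z <-> cabs (z - f x) @[x --> F] --> (0 : R).
Proof.
split => [/cvgrPdist_lt H|/cvgrPdist_lt H]; apply/cvgrPdist_lt => e e0.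
  have e0C : (0 : R[i]) < e%:C by rewrite ltcR.
  near=> x; rewrite sub0r normrN ger0_norm ?cabs_ge0//.
  rewrite -ltcR -norm_cabs; near: x; exact: H.
have [e' ee'] : exists e', e = e'%:C.
  by exists (complex.Re e); rewrite RRe_real// gtr0_real.
rewrite ee' ltcR in e0 *; near=> x; rewrite norm_cabs ltcR.
suff : `|0 - cabs (z - f x)| < e' by rewrite sub0r normrN ger0_norm// cabs_ge0.
by near: x; exact: H.
Unshelve. all: by end_near. Qed.

Lemma cvg_cabs (T : Type) (F : set_system T) {FF : Filter F} (f : T -> cplx R) z :
  f x @[x --> F] --> z -> cabs (f x) @[x --> F] --> cabs z.
Proof.
move/cvg_cabsP/cvgrPdist_lt => H; apply/cvgrPdist_lt => e e0; near=> x.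
rewrite (le_lt_trans (cabs_dist _ _))//.
suff : `|0 - cabs (z - f x)| < e by rewrite sub0r normrN ger0_norm// cabs_ge0.
by near: x; exact: H.
Unshelve. all: by end_near. Qed.

Lemma cplx_hausdorff : hausdorff_space (cplx R).
Proof. exact: norm_hausdorff. Qed.

Lemma bounded_series_cvg (u : nat -> R) K : (forall n, 0 <= u n) ->
  (forall N, \sum_(n < N) u n <= K) -> cvgn (series u).
Proof.
move=> u0 uK; apply: nondecreasing_is_cvgn.
  by apply/nondecreasing_seqP => n; rewrite /series/= big_nat_recr//= lerDl.
by exists K => _ [n _ <-]; rewrite /series/= big_mkord.
Qed.

(** The real and imaginary parts converge absolutely, each term being dominated by the modulus. *)
Lemma abs_series_cvg (u : nat -> cplx R) K :
  (forall N, \sum_(n < N) cabs (u n) <= K) ->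
  exists l : cplx R, series u @ \oo --> l.
Proof.
move=> uK.
have cR (v : nat -> R) : (forall n, `|v n| <= cabs (u n)) -> cvgn (series v).
  move=> vu; apply: normed_cvg.
  apply: (@bounded_series_cvg _ K) => [n|]; first exact: normr_ge0.
  move=> N; apply: le_trans (uK N); apply: ler_sum => i _; exact: vu.
have uRe n : `|complex.Re (u n)| <= cabs (u n).
  by rewrite -lecR -norm_cabs normc_ge_Re.
have uIm n : `|complex.Im (u n)| <= cabs (u n).
  rewrite cabsE; case: (u n) => a b /=.
  by rewrite -sqrtr_sqr ler_wsqrtr// lerDr sqr_ge0.
have /cvg_ex[a /cvgrPdist_lt Ha] := cR _ uRe.
have /cvg_ex[b /cvgrPdist_lt Hb] := cR _ uIm.
exists ((a +i* b)%C : cplx R); apply/cvg_cabsP/cvgrPdist_lt => e e0.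
have e20 : 0 < e / 2 by rewrite divr_gt0.
near=> n; rewrite sub0r normrN ger0_norm ?cabs_ge0//.
rewrite (le_lt_trans (cabs_ReIm _))// (splitr e) ltrD//.
  have -> : complex.Re ((a +i* b)%C - series u n) =
      a - series (fun n => complex.Re (u n)) n.
    by rewrite raddfB/= /series/= raddf_sum.
  by near: n; exact: Ha.
have -> : complex.Im ((a +i* b)%C - series u n) =
    b - series (fun n => complex.Im (u n)) n.
  by rewrite raddfB/= /series/= raddf_sum.
by near: n; exact: Hb.
Unshelve. all: by end_near. Qed.

End ComplexSeries.

(** * Termwise differentiation of power series *)

Section PowerSeries.
Context {R : realType}.
Implicit Types (z w h : cplx R) (a : nat -> cplx R) (r x y M : R).

Lemma cvg_cabs_le (u : nat -> cplx R) z x : (forall n, cabs (u n) <= x) ->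
  u @ \oo --> z -> cabs z <= x.
Proof.
move=> ux uz; have H : cabs (u n) @[n --> \oo] --> cabs z by exact: cvg_cabs.
rewrite -(cvg_lim _ H)//; apply: limr_le; first by apply/cvg_ex; exists (cabs z).
by near=> n; exact: ux.
Unshelve. all: by end_near. Qed.

(** The defect d_n satisfies d_(n+1) = (z + h) d_n + n z^(n-1) h^2, and n^2 + n <= (n + 1)^2 closes
    the induction. The factor r^2 stands on the left to avoid the exponent n - 2. *)
Lemma exprD_taylor2 z h n r : 0 < r -> cabs z <= r -> cabs (z + h) <= r ->
  cabs ((z + h) ^+ n - z ^+ n - h * (n%:R * z ^+ n.-1)) * r ^+ 2 <=
  cabs h ^+ 2 * (n%:R ^+ 2 * r ^+ n).
Proof.
move=> r0 zr zhr; elim: n => [|n IH].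
  by rewrite !expr0 subrr mul0r mulr0 subrr cabs0 mul0r expr0n !mul0r mulr0.
set d := (X in cabs X) in IH.
have nz : cabs (n%:R * z ^+ n.-1) * r ^+ 2 <= n%:R * r ^+ n.+1.
  case: n {IH d} => [|n]; first by rewrite !mul0r cabs0 mul0r.
  rewrite cabsM cabs_nat cabsX -mulrA ler_wpM2l//=.
  have -> : r ^+ n.+2 = r ^+ n * r ^+ 2 by rewrite -exprD addn2.
  rewrite ler_wpM2r//.
    by rewrite exprn_ge0// ltW.
  by rewrite lerXn2r ?nnegrE ?cabs_ge0// ltW.
have -> : (z + h) ^+ n.+1 - z ^+ n.+1 - h * (n.+1%:R * z ^+ n) =
    (z + h) * d + n%:R * z ^+ n.-1 * h ^+ 2.
  rewrite /d; case: n {IH d nz} => [|n]; first by rewrite !expr1 !expr0; ring.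
  by rewrite -[n.+2%:R]natr1 !exprS /=; ring.
rewrite (@le_trans _ _ ((cabs (z + h) * cabs d +
  cabs (n%:R * z ^+ n.-1) * cabs h ^+ 2) * r ^+ 2))//.
  rewrite ler_wpM2r ?exprn_ge0 ?(ltW r0)// -cabsM -cabsX -cabsM.
  exact: cabsD.
rewrite mulrDl -mulrA mulrAC.
have H1 : cabs (z + h) * (cabs d * r ^+ 2) <= r * (cabs h ^+ 2 * (n%:R ^+ 2 * r ^+ n)).
  by apply: ler_pM; rewrite ?mulr_ge0 ?cabs_ge0 ?exprn_ge0 ?(ltW r0).
have H2 : cabs (n%:R * z ^+ n.-1) * r ^+ 2 * cabs h ^+ 2 <= n%:R * r ^+ n.+1 * cabs h ^+ 2.
  by rewrite ler_wpM2r// exprn_ge0// cabs_ge0.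
apply: (le_trans (lerD H1 H2)).
have -> : r * (cabs h ^+ 2 * (n%:R ^+ 2 * r ^+ n)) + n%:R * r ^+ n.+1 * cabs h ^+ 2 =
   cabs h ^+ 2 * ((n%:R ^+ 2 + n%:R) * r ^+ n.+1) by rewrite [r ^+ n.+1]exprS; ring.
rewrite ler_wpM2l ?exprn_ge0 ?cabs_ge0// ler_wpM2r ?exprn_ge0 ?(ltW r0)//.
rewrite -natr1.
have : 0 <= n%:R :> R by [].
nra.
Qed.

(** Here n^2 <= (n + 1) (n + 2), and the latter is twice the coefficient of y^n in (1 - y)^(-3). *)
Lemma sum_sqr_expr_le N k : 0 <= k < 1 ->
  \sum_(n < N) n%:R ^+ 2 * k ^+ n <= 2 * (1 - k) `^ (- 3) :> R.
Proof.
move=> /andP[k0 k1].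
apply: (@le_trans _ _ (2 * \sum_(n < N) binom_coef 3 n * k ^+ n)).
  rewrite mulr_sumr; apply: ler_sum => n _; rewrite mulrA ler_wpM2r ?exprn_ge0//.
  have -> : 2 * binom_coef (3 : R) n = n.+1%:R * n.+2%:R.
    have := pochhammerD (1 : R) 2 n; rewrite !pochhammer1 add2n nat1r => E.
    rewrite /binom_coef mulrA -E !factS !natrM mulrA mulfK//.
    by rewrite mulrC.
  by rewrite -natrX -natrM ler_nat -mulnn leq_mul// ltnW.
rewrite ler_wpM2l// -subr_ge0; apply: binom_rem_ge0 => //.
by rewrite k0.
Qed.

Lemma power_series_derive a z0 z (rho : R) (f : cplx R -> cplx R) :
  (forall r, 0 <= r < rho -> exists M, forall n, cabs (a n) * r ^+ n <= M) ->
  (forall w, cabs (w - z0) < rho ->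
     series (fun n => a n * (w - z0) ^+ n) @ \oo --> f w) ->
  cabs (z - z0) < rho ->
  derivable f z 1 /\
  series (fun n => a n * (n%:R * (z - z0) ^+ n.-1)) @ \oo --> 'D_1 f z.
Proof.
move=> abnd fser zrho.
(* The radii cut the gap between |z - z0| and rho into thirds: the coefficients are controlled at
   r', and the ratio k = r / r' < 1 bounds the sums of n^2 r^n |a n|. *)
pose r := (2 * cabs (z - z0) + rho) / 3; pose r' := (cabs (z - z0) + 2 * rho) / 3.
have z1 := cabs_ge0 (z - z0).
have [zr rr' r'rho r0] : [/\ cabs (z - z0) < r, r < r', r' < rho & 0 < r].
  by rewrite /r /r'; split; lra.
clearbody r r'; have r'0 : 0 < r' by exact: lt_trans rr'.
have [M HM] : exists M, forall n, cabs (a n) * r' ^+ n <= M.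
  by apply: abnd; rewrite (ltW r'0).
have M0 : 0 <= M by apply: le_trans (HM 0%N); rewrite mulr_ge0 ?cabs_ge0 ?exprn_ge0 ?(ltW r'0).
pose k := r / r'.
have k01 : 0 <= k < 1 by rewrite divr_ge0 ?(ltW r0) ?(ltW r'0)//= ltr_pdivrMr// mul1r.
pose K := M * (2 * (1 - k) `^ (- 3)).
have K0 : 0 <= K by rewrite !mulr_ge0// powR_ge0.
have sK N : \sum_(n < N) cabs (a n) * (n%:R ^+ 2 * r ^+ n) <= K.
  apply: (@le_trans _ _ (\sum_(n < N) M * (n%:R ^+ 2 * k ^+ n))).
    apply: ler_sum => n _; rewrite mulrCA [leRHS]mulrCA ler_wpM2l ?exprn_ge0//.
    rewrite -[r in leLHS](@divfK _ r') ?gt_eqF// -/k exprMn mulrCA mulrC.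
    by rewrite ler_wpM2r ?HM// exprn_ge0//; case/andP: k01.
  by rewrite -mulr_sumr ler_wpM2l// sum_sqr_expr_le.
have [d Hd] : exists d : cplx R, series (fun n => a n * (n%:R * (z - z0) ^+ n.-1)) @ \oo --> d.
  apply: (@abs_series_cvg _ _ (K / r)) => N.
  rewrite ler_pdivlMr// mulr_suml; apply: le_trans (sK N); apply: ler_sum => n _.
  rewrite cabsM -mulrA ler_wpM2l ?cabs_ge0// cabsM cabs_nat cabsX.
  case: n => -[|n] ?/=; first by rewrite !mul0r expr0n/= mul0r.
  rewrite -mulrA ler_pM ?mulr_ge0 ?exprn_ge0 ?cabs_ge0 ?(ltW r0)//.
    by rewrite -natrX ler_nat -mulnn leq_pmull.
  by rewrite exprSr ler_wpM2r ?(ltW r0)// lerXn2r ?nnegrE ?cabs_ge0 ?(ltW r0)// ltW.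
pose C : numFieldType := R[i].
suff H : (h : C)^-1 *: (f (h *: (1 : cplx R) + z) - f z) @[h --> (0 : C)^'] --> d.
  split; first by apply/cvg_ex; exists d.
  by rewrite /derive (cvg_lim _ H).
(* The quadratic bound holds for all partial sums with the same K and passes to the limit; it gives
   differentiability at once. *)
have taylor h : cabs (z - z0 + h) <= r ->
    cabs (f (z + h) - f z - h * d) * r ^+ 2 <= cabs h ^+ 2 * K.
  move=> zhr; have zh1 : cabs (z + h - z0) < rho.
    by rewrite addrAC (le_lt_trans zhr)// (lt_trans rr').
  have C1 := fser _ zh1; have C2 := fser _ zrho.
  have C3 := cvgB (cvgB C1 C2) (cvgM (cvg_cst h) Hd).
  rewrite -ler_pdivlMr ?exprn_gt0//.
  apply: (cvg_cabs_le _ (C3 _ _ _ _)) => N /=.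
  rewrite ler_pdivlMr ?exprn_gt0//.
  rewrite !fctE /series/= !big_mkord -sumrB mulr_sumr -sumrB.
  apply: (@le_trans _ _ (\sum_(n < N)
    cabs h ^+ 2 * (cabs (a n) * (n%:R ^+ 2 * r ^+ n)))); last first.
    by rewrite -mulr_sumr ler_wpM2l// exprn_ge0// cabs_ge0.
  apply: (@le_trans _ _ ((\sum_(n < N) cabs (a n * (z + h - z0) ^+ n -
     a n * (z - z0) ^+ n - h * (a n * (n%:R * (z - z0) ^+ n.-1)))) * r ^+ 2)).
    rewrite ler_wpM2r ?exprn_ge0 ?(ltW r0)//.
    exact: (cabs_sum N (fun n => a n * (z + h - z0) ^+ n -
     a n * (z - z0) ^+ n - h * (a n * (n%:R * (z - z0) ^+ n.-1)))).
  rewrite mulr_suml; apply: ler_sum => n _.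
  rewrite (addrAC z h) [h * (a n * _)]mulrCA -!mulrBr cabsM [leRHS]mulrCA -mulrA.
  rewrite ler_wpM2l ?cabs_ge0//.
  exact: exprD_taylor2 (ltW zr) zhr.
apply/cvg_cabsP/cvgrPdist_lt => e e0.
near=> h.
have h0 : h != 0 by near: h; exact: nbhs_dnbhs_neq.
(* The first bound keeps z + h within radius r; the second makes |h| K / r^2 smaller than e, with K
   + 1 in place of K because K may vanish. *)
have hlt : `|h| < (Num.min (r - cabs (z - z0)) (e * r ^+ 2 / (K + 1)))%:C.
  near: h; apply: dnbhs0_lt; rewrite ltcR lt_min subr_gt0 zr/= divr_gt0 ?mulr_gt0 ?exprn_gt0//.
  by rewrite ltr_wpDl.
rewrite (norm_cabs (h : cplx R)) ltcR lt_min in hlt; have /andP[h1 h2] := hlt.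
rewrite sub0r normrN ger0_norm ?cabs_ge0//.
have E : d - h^-1 *: (f (h *: (1 : cplx R) + z) - f z) =
   - (h^-1 * (f (z + h) - f z - h * d)) :> cplx R.
  rewrite mulrBr mulKf// opprB; congr (_ - h^-1 * (f _ - _)).
  by rewrite addrC /GRing.scale/= mulr1.
rewrite E cabsN cabsM cabsV mulrC ltr_pdivrMr ?cabs_gt0//.
rewrite -(ltr_pM2r (exprn_gt0 2 r0)).
apply: le_lt_trans (taylor h _) _.
  by rewrite (le_trans (cabsD _ _))// -lerBrDl ltW.
have hp : 0 < cabs (h : cplx R) by rewrite cabs_gt0.
move: h2; rewrite ltr_pdivlMr; last by rewrite ltr_wpDl.
move=> h2; rewrite expr2 -mulrA mulrAC [ltRHS]mulrC ltr_pM2l//.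
apply: le_lt_trans h2; rewrite ler_wpM2l ?(ltW hp)// lerDl//.
Unshelve. all: by end_near. Qed.

End PowerSeries.

(** * Continuation of 2F1 to -1 *)

Section Continuation.
Context {R : realType}.
Implicit Types z : cplx R.

Lemma holo_continuous (f : cplx R -> cplx R) z : derivable f z 1 -> {for z, continuous f}.
Proof.
move=> df. apply: differentiable_continuous. exact/derivable1_diffP.
Qed.

Lemma open_cabs_ball (z0 : cplx R) (r : R) : open [set z | cabs (z - z0) < r].
Proof.
rewrite openE => z /= zr.
have e0 : (0 : R[i]) < (r - cabs (z - z0))%:C by rewrite ltcR subr_gt0.
rewrite /interior; apply/nbhs_ballP; exists (r - cabs (z - z0))%:C => //= w.
rewrite -ball_normE /= norm_cabs ltcR => h.
rewrite -(subrKA z) (le_lt_trans (cabsD _ _))// -[_ - z]opprB cabsN.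
by rewrite -ltrBrDr.
Qed.

(** The ball is the union of the segments from its centre, which all share that point. *)
Lemma connected_cabs_ball (z0 : cplx R) (r : R) : connected [set z | cabs (z - z0) < r].
Proof.
have [r0|r0] := leP r 0.
  rewrite (_ : mkset _ = set0); first exact: connected0.
  by apply/seteqP; split => // z /= /lt_le_trans /(_ r0); rewrite ltNge cabs_ge0.
pose phi z (t : R) : cplx R := z0 + of_real t * (z - z0).
rewrite (_ : mkset _ = \bigcup_(z in [set z | cabs (z - z0) < r]) (phi z @` `[0, 1])).
  apply: bigcup_connected.
    exists z0 => z /= zr; exists 0; first by rewrite /= in_itv/= lexx ler01.
    by rewrite /phi mul0r addr0.
  move=> z zr; apply: connected_continuous_connected.
    exact: segment_connected.
  apply: continuous_subspaceT => t.
  have Ft : Filter (nbhs t) by exact: nbhs_filter.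
  apply/(@cvg_cabsP R _ _ Ft).
  rewrite [X in X @ _ --> _](_ : _ = (fun u => `|t - u| * cabs (z - z0))).
    rewrite -[0 in X in _ --> X](mul0r (cabs (z - z0))); apply: cvgM; last exact: cvg_cst.
    rewrite -[0 in X in _ --> X](normr0 R) -(subrr t); apply: cvg_norm.
    by apply: cvgB; [exact: cvg_cst|exact: cvg_id].
  apply/funext => u; rewrite /phi opprD addrACA subrr add0r -mulrBl cabsM.
  by congr (_ * _); rewrite -cabs_real /of_real rmorphB.
apply/seteqP; split => [z zr|z [w /= wr [t]]].
  by exists z => //; exists 1; [rewrite /= in_itv/= lexx ler01|rewrite /phi mul1r addrC subrK].
rewrite /= in_itv/= => /andP[t0 t1] <-; rewrite /phi addrC addKr cabsM cabs_real.
by rewrite ger0_norm// (le_lt_trans _ wr)// ler_piMl// cabs_ge0.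
Qed.

Lemma unit_discE z : unit_disc z <-> cabs z < 1.
Proof. by rewrite /unit_disc/= norm_cabs -ltcR. Qed.

Lemma is_hyp2F1_unique (p q r w1 w2 : cplx R) :
  is_hyp2F1 p q r (-1) w1 -> is_hyp2F1 p q r (-1) w2 -> w1 = w2.
Proof.
move=> [U [g [_ [hg sg Um <-]]]] [V [f [_ [hf sf Vm <-]]]].
(* The points 1/(n+1) - 1 run from 0 to -1 inside the unit disc, where both continuations are the
   sum of the same series. *)
pose z n : cplx R := of_real (harmonic n) - 1.
have zm : z @ \oo --> (-1 : cplx R).
  apply/cvg_cabsP; rewrite [X in X @ _ --> _](_ : _ = harmonic); first exact: cvg_harmonic.
  apply/funext => n; rewrite /z opprB addKr cabsN cabs_real ger0_norm// /harmonic/= invr_ge0//.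
have gz : g (z n) @[n --> \oo] --> g (-1).
  by apply: continuous_cvg zm; apply: holo_continuous; exact: hg.
have fz : f (z n) @[n --> \oo] --> f (-1).
  by apply: continuous_cvg zm; apply: holo_continuous; exact: hf.
apply: (cvg_unique _ gz); first exact: cplx_hausdorff.
rewrite (_ : (fun n => g (z n)) = (fun n => f (z n)))//.
apply/funext => n.
have zd : unit_disc (z n).
  apply/unit_discE; rewrite /z (_ : _ - 1 = of_real (harmonic n - 1)); last first.
    by rewrite /of_real rmorphB rmorph1.
  rewrite cabs_real ler0_norm.
    by rewrite opprB ltrBlDr ltrDl /harmonic/= invr_gt0.
  by rewrite subr_le0 /harmonic/= invf_le1 ?ltr0n// ler1n.
by apply: (cvg_unique _ (sg _ zd) (sf _ zd)); exact: cplx_hausdorff.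
Qed.
End Continuation.

Section GammaRatio.
Context {R : realType}.
Implicit Types (p q s t x y : R).

Lemma Gamma_shift x k : 0 < x -> Gamma (x + k%:R) = pochhammer x k * Gamma x.
Proof.
move=> x0; elim: k => [|k IH]; first by rewrite addr0 pochhammer0 mul1r.
rewrite -natr1 addrA addrC GammaS; last by rewrite ltr_wpDr.
by rewrite IH pochhammerSr mulrA [pochhammer _ _ * _]mulrC.
Qed.

Definition Beta q s : R := Gamma q * Gamma s / Gamma (q + s).

Lemma Beta_gt0 q s : 0 < q -> 0 < s -> 0 < Beta q s.
Proof.
by move=> q0 s0; rewrite divr_gt0 ?mulr_gt0 ?Gamma_gt0// addr_gt0.
Qed.

Lemma Beta_shift q s k : 0 < q -> 0 < s ->
  Beta (q + k%:R) s = pochhammer q k / pochhammer (q + s) k * Beta q s.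
Proof.
move=> q0 s0; rewrite /Beta (addrAC q) !Gamma_shift ?addr_gt0//.
by rewrite mulf_div mulrA.
Qed.

Lemma beta_integral_monomial q s k h : 0 < q -> 0 < s ->
  beta_integral q s (fun t => k * t ^+ h) = k * Beta (q + h%:R) s.
Proof.
move=> q0 s0; rewrite beta_integralZ//; last exact/tameX/tame_id.
congr (_ * _); rewrite /Beta -beta_integral1 ?ltr_wpDr// -beta_integralX.
by apply: eq_beta_integral => t _; rewrite mulr1.
Qed.
End GammaRatio.

(** * Euler's integral expanded at 0 and at -1 *)

Section EulerIntegral.
Context {R : realType}.
Variables p q s : R.
Hypotheses (p0 : 0 <= p) (q0 : 0 < q) (s0 : 0 < s).
Implicit Types (t x y : R) (z : cplx R).

Let B0 : 0 < Beta q s := Beta_gt0 q0 s0.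

(* (1 - t z)^-p = (1 + t)^-p (1 - v t (z + 1))^-p, with v t in [0, 1/2]. *)
Let v t := t * (1 + t) `^ (- 1).

Let vE t : 0 < t < 1 -> v t = t / (1 + t).
Proof. by move=> /andP[t0 _]; rewrite /v powR_inv1// addr_ge0// ltW. Qed.

Let v_itv t : 0 < t < 1 -> 0 <= v t <= 2^-1.
Proof.
move=> t01; rewrite vE//; have /andP[t0 t1] := t01.
rewrite divr_ge0 ?addr_ge0 ?(ltW t0)//= ler_pdivrMr; lra.
Qed.

Let measurable_1D : measurable_fun [set: R] (fun t => 1 + t).
Proof. exact: measurable_funD. Qed.

Let ge1_1D t : 0 < t < 1 -> 1 <= 1 + t.
Proof. by move=> /andP[t0 _]; rewrite lerDl ltW. Qed.

Let tame_1D x : 0 <= x -> tame (fun t => (1 + t) `^ (- x)).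
Proof. by move=> x0; apply: tame_powRN. Qed.

Let tame_v : tame v.
Proof. by apply: tameM; [exact: tame_id|exact: tame_1D]. Qed.

(** Taylor coefficient at 0 of 2F1(p, q; q + s; z). *)
Definition hyp_coef j := binom_coef p j * (pochhammer q j / pochhammer (q + s) j).

Lemma hyp_coefE j :
  hyp_coef j = beta_integral q s (fun t => binom_coef p j * t ^+ j) / Beta q s.
Proof.
by rewrite beta_integral_monomial// Beta_shift// mulrA mulfK// gt_eqF.
Qed.

(** Coefficient of (z + 1)^k in Euler's integral, once (1 - v t (z + 1))^(-p) is expanded under the
    integral sign; for k = 0 it is the value wanted at -1. *)
Definition shifted_coef k := beta_integral q s
  (fun t => (1 + t) `^ (- p) * (binom_coef p k * v t ^+ k)) / Beta q s.

Let tame_shifted k : tame (fun t => (1 + t) `^ (- p) * (binom_coef p k * v t ^+ k)).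
Proof. by apply: tameM; [exact: tame_1D|apply/tameZ/tameX/tame_v]. Qed.

Lemma shifted_coef_ge0 k : 0 <= shifted_coef k.
Proof.
rewrite divr_ge0 ?(ltW B0)//.
rewrite -[X in X <= _](mul0r (beta_integral q s (fun=> 1))) -beta_integralZ//; last exact: tame_cst.
apply: le_beta_integral => //; first by apply: tameZ; exact: tame_cst.
move=> t t01; have /andP[v0 _] := v_itv t01; rewrite mul0r.
apply: mulr_ge0; first exact: powR_ge0.
by apply: mulr_ge0; [exact: binom_coef_ge0|exact: exprn_ge0].
Qed.

Lemma sum_shifted_coef N x : \sum_(k < N) shifted_coef k * x ^+ k = beta_integral q s
  (fun t => (1 + t) `^ (- p) * \sum_(k < N) binom_coef p k * (v t * x) ^+ k) / Beta q s.
Proof.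
rewrite (eq_bigr (fun k : 'I_N => beta_integral q s (fun t => x ^+ k *
   ((1 + t) `^ (- p) * (binom_coef p k * v t ^+ k))) / Beta q s)); last first.
  by move=> k _; rewrite beta_integralZ// /shifted_coef mulrAC [_ * x ^+ k]mulrC.
rewrite -mulr_suml -(@beta_integral_sum _ q s N (fun k t => x ^+ k *
   ((1 + t) `^ (- p) * (binom_coef p k * v t ^+ k))))//; last by move=> k; exact: tameZ.
congr (_ / _); apply: eq_beta_integral => t _; rewrite mulr_sumr.
by apply: eq_bigr => k _; rewrite [(v t * x) ^+ k]exprMn [LHS]mulrC -!mulrA.
Qed.

(** As v <= 1/2, the inner sum is at most (1 - x / 2)^(-p). This is what gives the series at -1 the
    radius of convergence 2. *)
Lemma sum_shifted_coef_le N x : 0 <= x < 2 ->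
  \sum_(k < N) shifted_coef k * x ^+ k <= (1 - x / 2) `^ (- p).
Proof.
move=> /andP[x0 x2]; rewrite sum_shifted_coef ler_pdivrMr// /Beta -beta_integral1//.
rewrite -beta_integralZ//; last exact: tame_cst.
apply: le_beta_integral => //.
- apply: tameM; first exact: tame_1D.
  apply: (@tame_sum _ N (fun k t => binom_coef p k * (v t * x) ^+ k)) => k.
  by apply/tameZ/tameX/tameM; [exact: tame_v|exact: tame_cst].
- by apply: tameZ; exact: tame_cst.
move=> t t01; rewrite mulr1; have /andP[v0 v1] := v_itv t01.
have vx : 0 <= v t * x <= x / 2.
  by rewrite mulr_ge0//= mulrC ler_wpM2l.
have /andP[vx0 vx2] := vx.
rewrite -[leRHS]mul1r ler_pM ?powR_ge0//.
- by apply: sumr_ge0 => i _; apply: mulr_ge0; [exact: binom_coef_ge0|exact: exprn_ge0].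
- by rewrite -[leRHS](powRr0 (1 + t)) ler_powR ?oppr_le0// ge1_1D.
apply: (@le_trans _ _ ((1 - v t * x) `^ (- p))).
  by rewrite -subr_ge0; apply: binom_rem_ge0 => //; rewrite vx0; lra.
rewrite !powRN lef_pV2 ?posrE ?powR_gt0//; [|lra|lra].
by apply: ge0_ler_powR => //; rewrite ?nnegrE; lra.
Qed.

(** The left side is the coefficient of z^j after re-expanding a partial sum at -1. Summed over all
    i, the inner series is (1 - v)^(-(p+j)) = (1 + t)^(p+j), which turns (1 + t)^(-p) v^j into t^j
    and so gives exactly the coefficient at 0; truncation only loses nonnegative terms. *)
Lemma sum_bin_shifted_coef_le N j :
  \sum_(k < N) 'C(k, j)%:R * shifted_coef k <= hyp_coef j.
Proof.
apply: (@le_trans _ _ (\sum_(k < j + N) 'C(k, j)%:R * shifted_coef k)).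
  rewrite addnC [leRHS]big_split_ord/= lerDl; apply: sumr_ge0 => i _.
  by rewrite mulr_ge0// shifted_coef_ge0.
rewrite big_split_ord/= big1 ?add0r; last first.
  by move=> i _; rewrite bin_small ?mul0r.
have binE i : 'C(j + i, j)%:R * binom_coef p (j + i) =
    binom_coef p j * binom_coef (p + j%:R) i.
  rewrite /binom_coef pochhammerD -(@bin_fact (j + i) j) ?leq_addr// addKn !natrM.
  have f1 : j`!%:R != 0 :> R by rewrite pnatr_eq0 -lt0n fact_gt0.
  have f2 : i`!%:R != 0 :> R by rewrite pnatr_eq0 -lt0n fact_gt0.
  have f3 : 'C(j + i, j)%:R != 0 :> R by rewrite pnatr_eq0 -lt0n bin_gt0 leq_addr.
  by field; rewrite f1 f2 f3.
rewrite (eq_bigr (fun i : 'I_N => beta_integral q s (fun t =>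
   (1 + t) `^ (- p) *
   (binom_coef p j * binom_coef (p + j%:R) i * v t ^+ (j + i))) / Beta q s)); last first.
  move=> i _; rewrite mulrA -beta_integralZ//; congr (_ / _).
  by apply: eq_beta_integral => t _; rewrite -binE mulrCA -!mulrA.
rewrite -mulr_suml -(@beta_integral_sum _ q s N (fun i t =>
   (1 + t) `^ (- p) *
   (binom_coef p j * binom_coef (p + j%:R) i * v t ^+ (j + i))))//; last first.
  by move=> i; apply: tameM; [exact: tame_1D|apply/tameZ/tameX/tame_v].
rewrite hyp_coefE ler_pM2r ?invr_gt0//.
apply: le_beta_integral => //.
- apply: (@tame_sum _ N (fun i t =>
   (1 + t) `^ (- p) * (binom_coef p j * binom_coef (p + j%:R) i * v t ^+ (j + i)))) => i.
  by apply: tameM; [exact: tame_1D|apply/tameZ/tameX/tame_v].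
- by apply/tameZ/tameX/tame_id.
move=> t t01; have /andP[v0 v1] := v_itv t01; have /andP[t0 t1] := t01.
have t10 : 0 < 1 + t by rewrite addr_gt0.
rewrite (eq_bigr (fun i : 'I_N => (1 + t) `^ (- p) * binom_coef p j * v t ^+ j *
    (binom_coef (p + j%:R) i * v t ^+ i))); last first.
  by move=> i _; rewrite exprD; ring.
rewrite -mulr_sumr.
have H : \sum_(i < N) binom_coef (p + j%:R) i * v t ^+ i <= (1 + t) `^ (p + j%:R).
  rewrite (_ : (1 + t) `^ _ = (1 - v t) `^ (- (p + j%:R))); last first.
    rewrite vE// (_ : 1 - _ = (1 + t) `^ (-1)); last first.
      by rewrite powR_inv1 ?(ltW t10)//; field; rewrite gt_eqF.
    by rewrite -powRrM mulrNN mul1r.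
  rewrite -subr_ge0; apply: binom_rem_ge0; first by rewrite addr_ge0.
  by rewrite v0 (le_lt_trans v1)// invf_lt1 ?ltr1n.
apply: (le_trans (ler_wpM2l _ H)).
  apply: mulr_ge0; last exact: exprn_ge0.
  by apply: mulr_ge0; [exact: powR_ge0|exact: binom_coef_ge0].
rewrite powRD ?(gt_eqF t10) ?implybT// powR_mulrn ?(ltW t10)// powRN vE// expr_div_n.
have P0 : (1 + t) `^ p != 0 by rewrite gt_eqF ?powR_gt0.
have X0 : (1 + t) ^+ j != 0 by rewrite expf_neq0// gt_eqF.
rewrite le_eqVlt; apply/orP; left; apply/eqP; field.
by rewrite P0 X0.
Qed.

(** The sum at 0 is bounded by the full (1 - t x)^(-p) = (1 + t)^(-p) (1 - v (1 + x))^(-p).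
    Subtracting the partial sum at -1 leaves a binomial remainder at v (1 + x) <= (1 + x) / 2 < 1,
    uniformly in t. *)
Lemma sum_coef_diff_le N x : 0 <= x < 1 ->
  \sum_(j < N) hyp_coef j * x ^+ j - \sum_(k < N) shifted_coef k * (1 + x) ^+ k <=
  binom_rem N p ((1 + x) / 2).
Proof.
move=> /andP[x0 x1].
have tame1 : tame (fun t => \sum_(j < N) x ^+ j * (binom_coef p j * t ^+ j)).
  apply: (@tame_sum _ N (fun j t => x ^+ j * (binom_coef p j * t ^+ j))) => j.
  by apply/tameZ/tameZ/tameX/tame_id.
have tame2 : tame (fun t => (1 + t) `^ (- p) * \sum_(k < N) binom_coef p k * (v t * (1 + x)) ^+ k).
  apply: tameM; first exact: tame_1D.
  apply: (@tame_sum _ N (fun k t => binom_coef p k * (v t * (1 + x)) ^+ k)) => k.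
  by apply/tameZ/tameX/tameM; [exact: tame_v|exact: tame_cst].
rewrite sum_shifted_coef (eq_bigr (fun j : 'I_N => beta_integral q s
    (fun t => x ^+ j * (binom_coef p j * t ^+ j)) / Beta q s)); last first.
  move=> j _; have tj : tame (fun t => binom_coef p j * t ^+ j).
    by apply/tameZ/tameX/tame_id.
  by rewrite (beta_integralZ _ q0 s0 tj) hyp_coefE [LHS]mulrC mulrA.
rewrite -mulr_suml -(@beta_integral_sum _ q s N (fun j t =>
  x ^+ j * (binom_coef p j * t ^+ j)))//; last first.
  by move=> j; apply/tameZ/tameZ/tameX/tame_id.
rewrite -mulrBl ler_pdivrMr// lerBlDr /Beta -beta_integral1//.
rewrite -beta_integralZ//; last exact: tame_cst.
rewrite -beta_integralD//; last by apply: tameZ; exact: tame_cst.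
apply: le_beta_integral => //; first by apply: tameD => //; apply: tameZ; exact: tame_cst.
move=> t t01; have /andP[v0 v1] := v_itv t01; have /andP[t0 t1] := t01.
have t10 : 0 < 1 + t by rewrite addr_gt0.
rewrite mulr1 -lerBlDr.
have tx : 0 <= t * x < 1.
  by rewrite mulr_ge0 ?(ltW t0)//= (le_lt_trans _ x1)// ler_piMl// ltW.
have /andP[tx0 tx1] := tx.
have H1 : \sum_(i < N) x ^+ i * (binom_coef p i * t ^+ i) <= (1 - t * x) `^ (- p).
  rewrite (eq_bigr (fun i : 'I_N => binom_coef p i * (t * x) ^+ i)).
    by rewrite -subr_ge0; apply: binom_rem_ge0.
  by move=> i _; rewrite exprMn mulrC -mulrA.
apply: le_trans (lerD H1 (lexx _)) _.
have y0 : 0 <= v t * (1 + x) by rewrite mulr_ge0// addr_ge0.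
have y1 : v t * (1 + x) <= (1 + x) / 2 by rewrite mulrC ler_wpM2l// addr_ge0.
have -> : (1 - t * x) `^ (- p) = (1 + t) `^ (- p) * (1 - v t * (1 + x)) `^ (- p).
  rewrite -powRM ?(ltW t10)//; last by lra.
  by congr (_ `^ _); rewrite vE//; field; rewrite gt_eqF.
rewrite -mulrBr -[leRHS]mul1r; apply: ler_pM; rewrite ?powR_ge0//.
- by apply: binom_rem_ge0 => //; rewrite y0; lra.
- by rewrite -[leRHS](powRr0 (1 + t)) ler_powR ?oppr_le0// ge1_1D.
by apply: le_binom_rem => //; lra.
Qed.

End EulerIntegral.

(** The binomial theorem padded with zero terms up to N, so that the double sum to be exchanged runs
    over a square. *)
Lemma expr1D_sum (K : comNzRingType) (z : K) k N : (k < N)%N ->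
  (1 + z) ^+ k = \sum_(j < N) 'C(k, j)%:R * z ^+ j.
Proof.
move=> kN; rewrite exprDn (big_ord_widen N (fun j => 1 ^+ (k - j) * z ^+ j *+ 'C(k, j)))//.
rewrite big_mkcond; apply: eq_bigr => j _; case: ifPn => [_|].
  by rewrite expr1n mul1r mulr_natl.
by rewrite -leqNgt => kj; rewrite bin_small ?mul0r.
Qed.

(** * The value of 2F1 at -1 *)

Section HypergeometricAtMinusOne.
Context {R : realType}.
Implicit Types (p q s t x y : R) (z w : cplx R).

Lemma of_realM x y : of_real (x * y) = of_real x * of_real y :> cplx R.
Proof. exact: rmorphM. Qed.
Lemma of_realD x y : of_real (x + y) = of_real x + of_real y :> cplx R.
Proof. exact: rmorphD. Qed.
Lemma of_realV x : of_real x^-1 = (of_real x)^-1 :> cplx R.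
Proof. exact: fmorphV. Qed.
Lemma of_real_nat n : of_real n%:R = n%:R :> cplx R.
Proof. exact: rmorph_nat. Qed.

Lemma of_real_pochhammer x n : of_real (pochhammer x n) = pochhammer (of_real x) n.
Proof.
elim: n => [|n IH]; first by rewrite !pochhammer0.
by rewrite !pochhammerSr of_realM IH of_realD of_real_nat.
Qed.

Lemma hyp_term2F1 p q s z n :
  hyp_term [:: of_real p; of_real q] [:: of_real (q + s)] z n =
  of_real (hyp_coef p q s n) * z ^+ n.
Proof.
rewrite /hyp_term !big_cons !big_nil !mulr1 pochhammer1 /hyp_coef /binom_coef.
rewrite !of_realM !of_realV !of_real_pochhammer of_real_nat invfM.
by congr (_ * _); rewrite [X in _ * X]mulrC mulrACA.
Qed.

(** The domain is the disc |z + 1| < 2: it contains the unit disc, and it avoids the cut because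
    every real number >= 1 is at distance at least 2 from -1. At the centre only the constant
    coefficient survives. *)
Lemma is_hyp2F1_minus1 p q s : 0 <= p -> 0 < q -> 0 < s ->
  is_hyp2F1 (of_real p) (of_real q) (of_real (q + s)) (-1)
    (of_real (shifted_coef p q s 0)).
Proof.
move=> p0 q0 s0; pose c := shifted_coef p q s; pose d := hyp_coef p q s.
have c0 k : 0 <= c k by exact: shifted_coef_ge0.
have cabs_c k : cabs (of_real (c k)) = c k by rewrite cabs_real ger0_norm.
pose g z : cplx R := limn (series (fun k => of_real (c k) * (z - -1) ^+ k)).
have gser z : cabs (z - -1) < 2 ->
    series (fun k => of_real (c k) * (z - -1) ^+ k) @ \oo --> g z.
  move=> z2; have [|l Hl] := @abs_series_cvg R
    (fun k => of_real (c k) * (z - -1) ^+ k) ((1 - cabs (z - -1) / 2) `^ (- p)).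
    move=> N; under eq_bigr do rewrite cabsM cabsX cabs_c.
    by apply: sum_shifted_coef_le => //; rewrite cabs_ge0.
  by rewrite /g; apply/cvg_ex; exists l.
have unit_sub z : unit_disc z -> cabs (z - -1) < 2.
  move/unit_discE => z1; rewrite (le_lt_trans (cabsD _ _))// opprK.
  by rewrite (_ : cabs 1 = cabs (of_real 1))// cabs_real normr1; lra.
exists [set z | cabs (z - -1) < 2], g; split; split.
- exact: open_cabs_ball.
- exact: connected_cabs_ball.
- exact: unit_sub.
- move=> z /= z2; apply/negP => z1.
  have : 2 <= cabs (z - -1); last by rewrite leNgt z2.
  move: z1; rewrite lecE => /andP[/eqP iz rz].
  rewrite -lecR -norm_cabs (le_trans _ (normc_ge_Re _))// lecR ler_normr.
  apply/orP; left; rewrite opprK raddfD/=; move: rz => /=; lra.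
- move=> z z2.
  have [|||//] := @power_series_derive R (fun k => of_real (c k)) (-1) z 2 g.
  + move=> r r2; exists ((1 - r / 2) `^ (- p)) => n; rewrite cabs_c.
    apply: le_trans (sum_shifted_coef_le p0 q0 s0 n.+1 r2).
    rewrite big_ord_recr/= lerDr; apply: sumr_ge0 => i _; rewrite mulr_ge0//.
    by rewrite exprn_ge0//; case/andP: r2.
  + exact: gser.
  + exact: z2.
- move=> z z1.
  have gz := gser _ (unit_sub _ z1).
  have -> : hyp_term [:: of_real p; of_real q] [:: of_real (q + s)] z =
      (fun j => of_real (d j) * z ^+ j).
    by apply/funext => j; exact: hyp_term2F1.
  pose x := cabs z; have x01 : 0 <= x < 1 by rewrite cabs_ge0/=; exact/unit_discE.
  have rem0 : binom_rem N p ((1 + x) / 2) @[N --> \oo] --> (0 : R).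
    by apply: cvg_binom_rem => //; have /andP[? ?] := x01; lra.
  (* After re-expansion in powers of z, the coefficient differences are nonnegative reals, so the
     modulus is largest at x = |z|, where the sums can be folded back and compared. *)
  have dist N : cabs (series (fun j => of_real (d j) * z ^+ j) N -
      series (fun k => of_real (c k) * (z - -1) ^+ k) N) <= binom_rem N p ((1 + x) / 2).
    apply: le_trans (sum_coef_diff_le p0 q0 s0 N x01).
    have exch (K : comNzRingType) (C : nat -> K) (y : K) :
      \sum_(k < N) C k * (1 + y) ^+ k =
      \sum_(j < N) (\sum_(k < N) 'C(k, j)%:R * C k) * y ^+ j.
      rewrite (eq_bigr (fun k : 'I_N => \sum_(j < N) 'C(k, j)%:R * C k * y ^+ j)).
        by rewrite exchange_big; apply: eq_bigr => j _; rewrite mulr_suml.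
      move=> k _; rewrite (@expr1D_sum _ y k N)// mulr_sumr.
      by apply: eq_bigr => j _; rewrite mulrA [C k * _]mulrC.
    rewrite /series/= !big_mkord opprK [z + 1]addrC.
    rewrite (exch _ (fun k => of_real (c k))) (exch _ c) -!sumrB.
    apply: le_trans (cabs_sum N (fun j => of_real (d j) * z ^+ j -
      (\sum_(k < N) 'C(k, j)%:R * of_real (c k)) * z ^+ j)) _.
    apply: ler_sum => j _; rewrite -!mulrBl cabsM cabsX.
    rewrite (_ : _ - _ = of_real (d j - \sum_(k < N) 'C(k, j)%:R * c k)).
      rewrite cabs_real ger0_norm// subr_ge0.
      exact: sum_bin_shifted_coef_le.
    rewrite /of_real rmorphB rmorph_sum; congr (_ - _); apply: eq_bigr => k _.
    by rewrite -of_real_nat -of_realM.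
  apply/cvg_cabsP.
  have gz0 : cabs (g z - series (fun k => of_real (c k) * (z - -1) ^+ k) N)
     @[N --> \oo] --> (0 : R) by apply/cvg_cabsP; exact: gz.
  apply: (@squeeze_cvgr _ _ _ _ (fun=> 0) (fun N =>
    cabs (g z - series (fun k => of_real (c k) * (z - -1) ^+ k) N) +
    binom_rem N p ((1 + x) / 2))).
  + near=> N; rewrite cabs_ge0/=.
    rewrite -[X in cabs X](subrKA (series (fun k => of_real (c k) * (z - -1) ^+ k) N)).
    rewrite (le_trans (cabsD _ _))// lerD2l.
    by rewrite -cabsN opprB dist.
  + exact: cvg_cst.
  + by rewrite -[0 in X in _ --> X](addr0 0); exact: cvgD.
- by rewrite /= subrr cabs0.
have z2 : cabs ((-1 : cplx R) - -1) < 2 by rewrite subrr cabs0.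
apply: (cvg_unique cplx_hausdorff (gser _ z2)).
apply: cvg_near_cst; exists 1%N => // -[//|N] _.
rewrite /series/= big_mkord big_ord_recl expr0 mulr1 big1 ?addr0// => i _.
by rewrite subrr exprS mul0r mulr0.
Unshelve. all: by end_near. Qed.

Lemma hyp2F1_real_minus1 p q s : 0 <= p -> 0 < q -> 0 < s ->
  hyp2F1_real p q (q + s) (-1) =
  beta_integral q s (fun t => (1 + t) `^ (- p)) / Beta q s.
Proof.
move=> p0 q0 s0; have H := is_hyp2F1_minus1 p0 q0 s0.
have E : of_real (-1) = -1 :> cplx R by rewrite /of_real rmorphN rmorph1.
rewrite /hyp2F1_real /hyp2F1 E (xget_unique 0 H) /=; last first.
  by move=> w Hw; exact: is_hyp2F1_unique Hw H.
rewrite /shifted_coef; congr (_ / _); apply: eq_beta_integral => t _.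
by rewrite /binom_coef pochhammer0 fact0 divr1 expr0 !mulr1.
Qed.

End HypergeometricAtMinusOne.

(** * The three series of the hypothesis *)

Section GammaSeries.
Context {R : realType}.
Implicit Types (p q s r t x y : R).

(** The product (1 + t) (1 + t^2) is (1 - t^4) / (1 - t): this is the bounded factor left by the
    quartic. *)
Definition quartic_integral p q s : R := beta_integral q s
  (fun t => (1 + t) `^ (- p) * (1 + t ^+ 2) `^ (- p)).

Lemma tame_1DX p n : 0 <= p -> tame (fun t : R => (1 + t ^+ n) `^ (- p)).
Proof.
move=> p0; apply: tame_powRN => //.
  apply: measurable_funD => //; have [m _] := @tameX R id n tame_id; exact: m.
by move=> t /andP[t0 _]; rewrite lerDl exprn_ge0// ltW.
Qed.

Lemma tame_1D p : 0 <= p -> tame (fun t : R => (1 + t) `^ (- p)).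
Proof. by move=> p0; have := @tame_1DX p 1 p0; under eq_fun do rewrite expr1. Qed.

(** The common shape of the three series, with (p, q, r) equal to (A, B, c - A), (A + 1, B + 4, c -
    A + 3) and (A + 2, B + 8, c - A + 6). In each case r - q is positive and becomes the second Beta
    parameter. *)
Definition gamma_series_term p q r n : R :=
  gbinom (- p) n * (Gamma (q + 2 * n%:R) / Gamma (r + 2 * n%:R))
  * hyp2F1_real p (q + 2 * n%:R) (r + 2 * n%:R) (-1).

(** The quotient of Gamma values times Gamma(s) is Beta(q + 2n, s), exactly the normalisation in
    Euler's integral; the shift by 2n is then t^(2n) under the integral. *)
Lemma gamma_series_termE p q s n : 0 <= p -> 0 < q -> 0 < s ->
  Gamma s * gamma_series_term p q (q + s) n =
  beta_integral q s (fun t => (1 + t) `^ (- p) * (binom_coef p n * (- t ^+ 2) ^+ n)).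
Proof.
move=> p0 q0 s0; rewrite /gamma_series_term -natrM (addrAC q s).
have qn : 0 < q + (2 * n)%:R by rewrite ltr_wpDr.
rewrite hyp2F1_real_minus1//.
have -> : gbinom (- p) n = (-1) ^+ n * binom_coef p n.
  by rewrite /gbinom opprK /binom_coef mulrA.
have G1 := Gamma_gt0 qn; have G2 := Gamma_gt0 s0; have G3 := Gamma_gt0 (addr_gt0 qn s0).
transitivity ((-1) ^+ n * binom_coef p n *
   beta_integral (q + (2 * n)%:R) s (fun t => (1 + t) `^ (- p))).
  rewrite /Beta; move: (beta_integral _ _ _) (binom_coef p n) => i w.
  move: (Gamma _) (Gamma s) (Gamma _) G1 G2 G3 => g1 g2 g3 G1 G2 G3.
  by field; rewrite !gt_eqF.
rewrite -beta_integralX -beta_integralZ//; last first.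
  by apply: tameM; [exact/tameX/tame_id|exact: tame_1D].
apply: eq_beta_integral => t _.
by rewrite (exprNn (t ^+ 2)) -exprM; ring.
Qed.

Lemma gamma_series_rem p q s N : 0 <= p -> 0 < q -> 0 < s ->
  quartic_integral p q s - Gamma s * series (gamma_series_term p q (q + s)) N =
  beta_integral q s (fun t => (1 + t) `^ (- p) * binom_rem N p (- t ^+ 2)).
Proof.
move=> p0 q0 s0.
have tk k : tame (fun t => (1 + t) `^ (- p) * (binom_coef p k * (- t ^+ 2) ^+ k)).
  apply: tameM; [exact: tame_1D|apply/tameZ/tameX].
  have -> : (fun t : R => - t ^+ 2) = (fun t => -1 * t ^+ 2).
    by apply/funext => t; rewrite mulN1r.
  by apply/tameZ/tameX/tame_id.
have tS := tame_sum N tk.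
have tQ : tame (fun t : R => (1 + t) `^ (- p) * (1 + t ^+ 2) `^ (- p)).
  by apply: tameM; [exact: tame_1D|exact: tame_1DX].
rewrite /series/= big_mkord mulr_sumr.
under eq_bigr do rewrite gamma_series_termE//.
rewrite -(@beta_integral_sum _ q s N _ q0 s0 tk) -mulN1r.
rewrite -(beta_integralZ _ q0 s0 tS) -(beta_integralD q0 s0 tQ); last exact: tameZ.
apply: eq_beta_integral => t _; rewrite /binom_rem opprK mulrBr mulN1r; congr (_ - _).
by rewrite mulr_sumr.
Qed.

Lemma tame_gamma_rem p N : 0 <= p ->
  tame (fun t => (1 + t) `^ (- p) * binom_rem N p (- t ^+ 2) : R).
Proof.
move=> p0; apply: tameM; first exact: tame_1D.
rewrite /binom_rem.
have -> : (fun t : R => (1 - - t ^+ 2) `^ (- p) - \sum_(k < N) binom_coef p k * (- t ^+ 2) ^+ k)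
  = (fun t => (1 + t ^+ 2) `^ (- p) + -1 * \sum_(k < N) binom_coef p k * (-1 * t ^+ 2) ^+ k).
  by apply/funext => t; rewrite opprK !mulN1r.
apply: tameD; first exact: tame_1DX.
apply: tameZ; apply: (@tame_sum _ N (fun k t => binom_coef p k * (-1 * t ^+ 2) ^+ k)) => k.
by apply/tameZ/tameX/tameZ/tameX/tame_id.
Qed.

(* Consecutive remainders of the binomial series at [- t ^+ 2] have opposite
   signs, so the limit of the partial sums has to be the integral, even when
   the convergence is only conditional. *)
Lemma lim_gamma_series p q s : 0 <= p -> 0 < q -> 0 < s ->
  cvgn (series (gamma_series_term p q (q + s))) ->
  Gamma s * limn (series (gamma_series_term p q (q + s))) = quartic_integral p q s.
Proof.
move=> p0 q0 s0 cT; set L := limn _.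
pose D N := quartic_integral p q s - Gamma s * series (gamma_series_term p q (q + s)) N.
have Dsign N : 0 <= (-1) ^+ N * D N.
  rewrite /D gamma_series_rem//.
  rewrite -beta_integralZ//; last exact: tame_gamma_rem.
  rewrite -[X in X <= _](mul0r (beta_integral q s (fun=> 1))).
  rewrite -beta_integralZ//; last exact: tame_cst.
  apply: le_beta_integral => //.
  - by apply: tameZ; exact: tame_cst.
  - by apply: tameZ; exact: tame_gamma_rem.
  move=> t t01; rewrite mul0r mulrCA; apply: mulr_ge0; first exact: powR_ge0.
  by apply: binom_rem_sign => //; rewrite oppr_le0 sqr_ge0.
have DD N : D N * D N.+1 <= 0.
  have := mulr_ge0 (Dsign N) (Dsign N.+1).
  by rewrite exprS mulN1r mulNr mulrN mulrACA -expr2 sqrr_sign mul1r oppr_ge0.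
have cD : D @ \oo --> quartic_integral p q s - Gamma s * L.
  by apply: cvgB; [exact: cvg_cst|apply: cvgM; [exact: cvg_cst|exact: cT]].
have cDS : (fun N => D N.+1) @ \oo --> quartic_integral p q s - Gamma s * L.
  by rewrite cvg_shiftS.
have cDD := cvgM cD cDS.
have : (quartic_integral p q s - Gamma s * L) ^+ 2 <= 0.
  have H : (fun N => D N * D N.+1) @ \oo --> (quartic_integral p q s - Gamma s * L) ^+ 2.
    by rewrite expr2; exact: cvgM.
  rewrite -(cvg_lim _ H)//; apply: limr_le; first by apply/cvg_ex; eexists; exact: H.
  by near=> N; exact: DD.
by rewrite le_eqVlt ltNge sqr_ge0 orbF sqrf_eq0 subr_eq0 => /eqP.
Unshelve. all: by end_near. Qed.

(** The extra [p] in the second Beta parameter provides a factor (1-t)^p, which cancels the singular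
    part of (1 - t^4)^(-p), so that only bounded functions meet the weight. *)
Lemma sum_Beta_le p q s N : 0 <= p -> 0 < q -> 0 < s ->
  \sum_(m < N) binom_coef p m * Beta (q + (4 * m)%:R) (s + p) <= quartic_integral p q s.
Proof.
move=> p0 q0 s0; have sp0 : 0 < s + p by rewrite ltr_wpDr.
have tm m : tame (fun t : R => binom_coef p m * t ^+ (4 * m)) by apply/tameZ/tameX/tame_id.
under eq_bigr do rewrite -beta_integral_monomial//.
rewrite -(@beta_integral_sum _ q (s + p) N _ q0 sp0 tm) beta_integral_compl.
apply: le_beta_integral => //.
- split.
    apply: measurable_funM; last by have [] := tame_sum N tm.
    by apply: (measurableT_comp (measurable_powR _)); exact: measurable_funB.
  have [_ [M HM]] := tame_sum N tm.
  exists M => t t01; rewrite normrM -[M]mul1r ler_pM ?HM//.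
  have /andP[t0 t1] := t01.
  rewrite ger0_norm ?powR_ge0// -[leRHS](_ : 1 `^ p = 1); last by rewrite powR1.
  by apply: ge0_ler_powR => //; rewrite ?nnegrE; lra.
- by apply: tameM; [exact: tame_1D|exact: tame_1DX].
move=> t /andP[t0 t1].
have t41 : t ^+ 4 < 1 by rewrite exprn_ilt1// ltW.
have H : \sum_(k < N) binom_coef p k * t ^+ (4 * k) <= (1 - t ^+ 4) `^ (- p).
  under eq_bigr do rewrite exprM.
  by rewrite -subr_ge0; apply: binom_rem_ge0 => //; rewrite exprn_ge0 ?(ltW t0).
have t10 : 0 < 1 - t by lra.
have t20 : 0 < 1 + t by lra.
have t30 : 0 < 1 + t ^+ 2 by rewrite ltr_wpDr// sqr_ge0.
apply: (le_trans (ler_wpM2l (powR_ge0 _ _) H)).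
rewrite (_ : 1 - t ^+ 4 = (1 - t) * ((1 + t) * (1 + t ^+ 2))); last by ring.
rewrite !powRM ?mulr_ge0 ?(ltW t10) ?(ltW t20) ?(ltW t30)//.
by rewrite [(1 - t) `^ (- p)]powRN mulVKf ?gt_eqF ?powR_gt0.
Qed.

Lemma sum_Beta_le_gamma_series p q s N : 0 <= p -> 0 < q -> 0 < s ->
  cvgn (series (gamma_series_term p q (q + s))) ->
  \sum_(m < N) binom_coef p m * Beta (q + (4 * m)%:R) (s + p) <=
  Gamma s * limn (series (gamma_series_term p q (q + s))).
Proof. by move=> p0 q0 s0 cT; rewrite lim_gamma_series// sum_Beta_le. Qed.

End GammaSeries.

(** * A coefficient criterion for the class C *)

Section ClassC.
Context {R : realType}.
Implicit Types (z w : cplx R) (a : nat -> cplx R) (f : cplx R -> cplx R).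

(** Bounded coefficients suffice on the unit disc. The conclusion is phrased for z f' so that it can
    be applied a second time, to z f' itself. *)
Lemma unit_disc_series_derive a (M : R) f : (forall n, cabs (a n) <= M) ->
  (forall z, unit_disc z -> series (fun n => a n * z ^+ n) @ \oo --> f z) ->
  holomorphic_on (@unit_disc R) f /\
  forall z, unit_disc z ->
    series (fun n => n%:R * a n * z ^+ n) @ \oo --> z * 'D_1 f z.
Proof.
move=> aM fser.
have H z : unit_disc z -> derivable f z 1 /\
    series (fun n => a n * (n%:R * (z - 0) ^+ n.-1)) @ \oo --> 'D_1 f z.
  move/unit_discE => z1; apply: (@power_series_derive R a 0 z 1 f).
  - move=> r /andP[r0 r1]; exists M => n.
    rewrite (le_trans _ (aM n))// ler_piMr ?cabs_ge0// exprn_ile1//.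
    exact: ltW.
  - move=> w; rewrite subr0 => w1; exact/fser/unit_discE.
  - by rewrite subr0.
split=> [z /H[]//|z /H[_ Hz]].
rewrite (_ : series _ = (fun N => z * series (fun n => a n * (n%:R * (z - 0) ^+ n.-1)) N)).
  by apply: cvgM; [exact: cvg_cst|exact: Hz].
apply/funext => N; rewrite /series/= !big_mkord mulr_sumr; apply: eq_bigr => -[n nN] _ /=.
rewrite subr0; case: n nN => [|n] _; first by rewrite !mul0r !mulr0.
by rewrite exprS /=; ring.
Qed.

Lemma cabsMX w z n : cabs (w * z ^+ n) = cabs w * cabs z ^+ n.
Proof. by rewrite cabsM cabsX. Qed.

(** Meant for g = z f'(z) and h = z (z f')'(z), where the claim reads |h - g| < lam |g|. Splitting n
    (n + lam - 1) into n (n - 1) and lam n bounds |h - g| + lam |g - z| by lam |z|^2, the term n = 1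
    having used up lam of the 2 lam. That g does not vanish then follows, since |h - g| < 0 is
    impossible. *)
Lemma starlike_quotient a (lam : R) z (g h : cplx R) : 0 < lam -> a 1%N = 1 ->
  (forall N, \sum_(n < N) n%:R * (n%:R + lam - 1) * cabs (a n) <= 2 * lam) ->
  unit_disc z -> z != 0 ->
  series (fun n => n%:R * a n * z ^+ n) @ \oo --> g ->
  series (fun n => n%:R * (n%:R * a n) * z ^+ n) @ \oo --> h ->
  g != 0 /\ cabs (h / g - 1) < lam.
Proof.
move=> l0 a1 asum zd z0 Hg Hh.
have term_ge0 n : 0 <= n%:R * (n%:R + lam - 1) * cabs (a n).
  case: n => [|n]; first by rewrite !mul0r.
  rewrite !mulr_ge0 ?cabs_ge0// -natr1 addrAC addrK.
  by rewrite addr_ge0// ltW.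
have x1 : cabs z < 1 by exact/unit_discE.
have x0 : 0 < cabs z by rewrite cabs_gt0.
set x := cabs z in x0 x1.
have shift2 (u : nat -> cplx R) (l : cplx R) : u @ \oo --> l -> (fun N => u N.+2) @ \oo --> l.
  by move=> ul; rewrite (cvg_shiftS (fun N => u N.+1)) cvg_shiftS.
have tailsum N : \sum_(i < N) i.+2%:R * (i.+2%:R + lam - 1) * cabs (a i.+2) <= lam.
  have := asum N.+2; rewrite !big_ord_recl /= !mul0r add0r.
  rewrite -[(bump 0 0)%:R]/(1%:R) /= a1 (_ : cabs 1 = 1); last first.
    by rewrite (_ : cabs 1 = cabs (of_real 1))// cabs_real normr1.
  by rewrite mulr1 mul1r [1 + lam]addrC addrK mulr_natl mulr2n lerD2l.
have key : cabs (h - g) + lam * cabs (g - z) <= lam * x ^+ 2.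
  pose P N := series (fun n => n%:R * (n%:R * a n) * z ^+ n) N.+2 -
    series (fun n => n%:R * a n * z ^+ n) N.+2.
  pose Q N := series (fun n => n%:R * a n * z ^+ n) N.+2 - z.
  have HP : P @ \oo --> h - g by exact: (cvgB (shift2 _ _ Hh) (shift2 _ _ Hg)).
  have HQ : Q @ \oo --> g - z.
    exact: (cvgB (shift2 _ _ Hg) (cvg_cst z)).
  have HPQ : (fun N => cabs (P N) + lam * cabs (Q N)) @ \oo -->
      cabs (h - g) + lam * cabs (g - z).
    exact: (cvgD (cvg_cabs HP) (cvgM (cvg_cst lam) (cvg_cabs HQ))).
  rewrite -(cvg_lim _ HPQ)//; apply: limr_le; first by apply/cvg_ex; eexists; exact: HPQ.
  near=> N.
  have -> : P N = \sum_(i < N) (i.+2%:R * (i.+2%:R - 1) * a i.+2 * z ^+ i.+2).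
    rewrite /P /series/= !big_mkord -sumrB !big_ord_recl/= !mul0r subrr add0r.
    rewrite -[(bump 0 0)%:R]/(1%:R) !mul1r subrr add0r; apply: eq_bigr => i _.
    by rewrite -[(bump 0 (bump 0 i))]/(i.+2); ring.
  have -> : Q N = \sum_(i < N) (i.+2%:R * a i.+2 * z ^+ i.+2).
    rewrite /Q /series/= !big_mkord !big_ord_recl/= !mul0r add0r.
    rewrite -[(bump 0 0)%:R]/(1%:R) !mul1r a1 mul1r -[bump 0 0]/1%N expr1 addrAC subrr add0r.
    by apply: eq_bigr.
  have B1 := cabs_sum N (fun i => i.+2%:R * (i.+2%:R - 1) * a i.+2 * z ^+ i.+2).
  have B2 := cabs_sum N (fun i => i.+2%:R * a i.+2 * z ^+ i.+2).
  apply: le_trans (lerD B1 (ler_wpM2l (ltW l0) B2)) _.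
  rewrite mulr_sumr -big_split/=.
  apply: (@le_trans _ _ (\sum_(i < N) i.+2%:R * (i.+2%:R + lam - 1) * cabs (a i.+2) * x ^+ 2)).
    apply: ler_sum => i _.
    rewrite (_ : i.+2%:R - 1 = i.+1%:R :> cplx R); last by rewrite -natr1 addrK.
    rewrite !cabsMX !cabsM !cabs_nat -/x.
    rewrite (_ : _ + _ = i.+2%:R * (i.+2%:R + lam - 1) * cabs (a i.+2) * x ^+ i.+2).
      rewrite ler_wpM2l//.
      by rewrite -[i.+2]addn2 exprD ler_piMl ?exprn_ge0 ?(ltW x0)// exprn_ile1 ?(ltW x0)// ltW.
    by rewrite -[i.+2%:R]natr1; ring.
  by rewrite -mulr_suml ler_wpM2r// exprn_ge0// ltW.
(* The gap between |z|^2 and |z|, where z != 0 enters, makes the final inequality strict. *)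
have xx : x ^+ 2 < x by rewrite expr2 gtr_pMl.
have xg : x <= cabs g + cabs (g - z).
  by rewrite /x -{1}(subKr g z) (le_trans (cabsD _ _))// cabsN.
have lt_main : cabs (h - g) < lam * cabs g.
  have : lam * x <= lam * (cabs g + cabs (g - z)) by rewrite ler_wpM2l// ltW.
  have : lam * x ^+ 2 < lam * x by rewrite ltr_pM2l.
  move: key; lra.
have g0 : g != 0.
  apply: contraTneq lt_main => ->; rewrite cabs0 mulr0 -leNgt; exact: cabs_ge0.
split=> //; rewrite -[1](divff g0) -mulrBl cabsM cabsV ltr_pdivrMr//.
by rewrite cabs_gt0.
Unshelve. all: by end_near. Qed.

Lemma classC_coef a (lam : R) f : 0 < lam -> a 0%N = 0 -> a 1%N = 1 ->
  (forall z, unit_disc z -> series (fun n => a n * z ^+ n) @ \oo --> f z) ->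
  (forall N, \sum_(n < N) n%:R * (n%:R + lam - 1) * cabs (a n) <= 2 * lam) ->
  classC lam f.
Proof.
move=> l0 a0 a1 fser asum.
have term_ge0 n : 0 <= n%:R * (n%:R + lam - 1) * cabs (a n).
  case: n => [|n]; first by rewrite !mul0r.
  rewrite !mulr_ge0 ?cabs_ge0// -natr1 addrAC addrK.
  by rewrite addr_ge0// ltW.
(* A single term of the sum gives n lam |a n| <= n (n + lam - 1) |a n| <= 2 lam for n >= 1. *)
have na n : cabs (n%:R * a n) <= 2.
  case: n => [|n]; first by rewrite mul0r cabs0.
  rewrite cabsM cabs_nat -(ler_pM2r l0).
  apply: le_trans (asum n.+2); rewrite big_ord_recr/=.
  apply: (@le_trans _ _ (n.+1%:R * (n.+1%:R + lam - 1) * cabs (a n.+1))).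
    rewrite mulrAC ler_wpM2r ?cabs_ge0// ler_wpM2l//.
    by rewrite -natr1 addrAC addrK lerDr.
  by rewrite lerDr; apply: sumr_ge0.
have aM n : cabs (a n) <= 2.
  case: n => [|n]; first by rewrite a0 cabs0.
  apply: le_trans (na n.+1); rewrite cabsM cabs_nat.
  by rewrite ler_peMl ?cabs_ge0// ler1n.
have [fh gser] := unit_disc_series_derive aM fser.
have [gh hser] := unit_disc_series_derive na gser.
split; first by split=> //; exists a.
split.
  split=> //; exists (fun n => n%:R * a n); split; [by rewrite mul0r|by rewrite a1 mulr1|].
  exact: gser.
move=> z zd z0.
exact: (starlike_quotient l0 a1 asum zd z0 (gser z zd) (hser z zd)).
Qed.

End ClassC.

(** * The coefficients of the 5F4 and their weighted sum *)

Section QuarticParameters.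
Context {R : realType}.

(** The multiplication formula for Pochhammer symbols with step 4. The powers of 4 cancel between
    the numerator and denominator parameters of the 5F4. *)
Lemma pochhammer_quadruple (K : numFieldType) (x : K) n :
  pochhammer (x / 4) n * (pochhammer ((x + 1) / 4) n *
    (pochhammer ((x + 2) / 4) n * pochhammer ((x + 3) / 4) n)) =
  pochhammer x (4 * n) / (4 ^+ 4) ^+ n.
Proof.
elim: n => [|n IH]; first by rewrite muln0 !pochhammer0 expr0 divr1 !mulr1.
have E : pochhammer x (4 * n.+1) = pochhammer x (4 * n) *
    ((x + 4 * n%:R) * (x + 4 * n%:R + 1) * (x + 4 * n%:R + 2) * (x + 4 * n%:R + 3)).
  by rewrite mulnSr pochhammerD natrM !pochhammerSr pochhammer0 addr0 mul1r.
rewrite E !pochhammerSr [(4 ^+ 4) ^+ n.+1]exprS invfM.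
rewrite [RHS](_ : _ = pochhammer x (4 * n) / (4 ^+ 4) ^+ n * ((4 ^+ 4)^-1 *
   ((x + 4 * n%:R) * (x + 4 * n%:R + 1) * (x + 4 * n%:R + 2) * (x + 4 * n%:R + 3)))); last first.
  by ring.
by rewrite -IH; field; rewrite ?pnatr_eq0.
Qed.

Definition hyp5F4_coef (a b c : cplx R) n : cplx R :=
  pochhammer a n * pochhammer b (4 * n) / (pochhammer c (4 * n) * n`!%:R).

Lemma hyp5F4_term (a b c z : cplx R) n :
  hyp_term [:: a; b / 4; (b + 1) / 4; (b + 2) / 4; (b + 3) / 4]
    [:: c / 4; (c + 1) / 4; (c + 2) / 4; (c + 3) / 4] z n =
  hyp5F4_coef a b c n * z ^+ n.
Proof.
rewrite /hyp_term !big_cons !big_nil !mulr1 pochhammer1.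
rewrite (@pochhammer_quadruple R[i] b) (@pochhammer_quadruple R[i] c).
congr (_ * _); rewrite /hyp5F4_coef.
have n0 : ((4 : R[i]) ^+ 4) ^+ n != 0 by rewrite !expf_neq0// pnatr_eq0.
rewrite !invfM invrK.
rewrite -!mulrA; congr (_ * (_ * _)).
by rewrite mulrCA; congr (_ * _); rewrite mulrA mulVf ?mul1r.
Qed.

Lemma cabs_pochhammer_le (x : cplx R) n :
  cabs (pochhammer x n) <= pochhammer (cabs x) n.
Proof.
elim: n => [|n IH].
  by rewrite !pochhammer0 (_ : cabs 1 = cabs (of_real 1))// cabs_real normr1.
rewrite !pochhammerSr cabsM ler_pM ?cabs_ge0//.
by rewrite (le_trans (cabsD _ _))// cabs_nat.
Qed.

Lemma cabs_hyp5F4_coef_le (a b : cplx R) (c : R) n : 0 < c ->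
  cabs (hyp5F4_coef a b (of_real c) n) <=
  binom_coef (cabs a) n * (pochhammer (cabs b) (4 * n) / pochhammer c (4 * n)).
Proof.
move=> c0; have P0 := pochhammer_gt0 (4 * n) c0.
have F0 : 0 < n`!%:R :> R by rewrite ltr0n fact_gt0.
rewrite /hyp5F4_coef /binom_coef -of_real_pochhammer -of_real_nat -of_realM -of_realV.
rewrite cabsM cabs_real ger0_norm ?invr_ge0 ?mulr_ge0 ?(ltW P0)//.
rewrite [leRHS](_ : _ = pochhammer (cabs a) n * pochhammer (cabs b) (4 * n) *
  (pochhammer c (4 * n) * n`!%:R)^-1); last by field; rewrite !gt_eqF.
rewrite ler_wpM2r ?invr_ge0 ?mulr_ge0 ?(ltW P0)// cabsM.
by rewrite ler_pM ?cabs_ge0 ?cabs_pochhammer_le.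
Qed.

(** Multiplying by Beta(B, c - B) turns each (B)_4n / (c)_4n into Beta(B + 4n, c - B). The three
    parts of the weight are then bounded separately, with second Beta parameters s + 2, s + 1 and s
    for their series. *)
Lemma weighted_sum_le (A B c lam : R) N
    (L1 := limn (series (gamma_series_term (A + 2) (B + 8) (c - A + 6))))
    (L2 := limn (series (gamma_series_term (A + 1) (B + 4) (c - A + 3))))
    (L3 := limn (series (gamma_series_term A B (c - A)))) :
  0 < A -> 0 < B -> A + B + 2 < c -> 0 < lam ->
  cvgn (series (gamma_series_term (A + 2) (B + 8) (c - A + 6))) ->
  cvgn (series (gamma_series_term (A + 1) (B + 4) (c - A + 3))) ->
  cvgn (series (gamma_series_term A B (c - A))) ->
  Gamma c * Gamma (c - A - B) / (Gamma B * Gamma (c - B))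
  * (pochhammer A 2 / pochhammer (c - A - B - 2) 2 * L1
     + (lam + 2) * A / (c - A - B - 1) * L2
     + lam * L3)
  <= 2 * lam ->
  \sum_(n < N) (n%:R + 1) * (n%:R + lam) *
    (binom_coef A n * (pochhammer B (4 * n) / pochhammer c (4 * n))) <= 2 * lam.
Proof.
move=> A0 B0 cAB l0; pose s := c - A - B - 2.
have s0 : 0 < s by rewrite /s; lra.
have cB0 : 0 < c - B by lra.
have c0 : 0 < c by lra.
have l2 : 0 <= lam + 2 by lra.
move=> c1 c2 c3 ineq.
pose X n := binom_coef A n * (pochhammer B (4 * n) / pochhammer c (4 * n)).
have X0 n : 0 <= X n.
  apply: mulr_ge0; first exact/binom_coef_ge0/ltW.
  by apply: divr_ge0; apply: pochhammer_ge0; exact: ltW.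
have BT0 := Beta_gt0 B0 cB0.
have XB n : X n * Beta B (c - B) = binom_coef A n * Beta (B + (4 * n)%:R) (c - B).
  by rewrite Beta_shift// [B + (c - B)]addrC subrK /X !mulrA.
have H3 M : \sum_(n < M) X n * Beta B (c - B) <= Gamma (s + 2) * L3.
  have E : B + (s + 2) = c - A by rewrite /s; ring.
  have := @sum_Beta_le_gamma_series R A B (s + 2) M (ltW A0) B0.
  rewrite E => /(_ (addr_gt0 s0 (ltr0n _ 2)) c3); apply: le_trans.
  rewrite le_eqVlt; apply/orP; left; apply/eqP; apply: eq_bigr => n _.
  by rewrite XB; congr (_ * Beta _ _); rewrite /s; ring.
(* The factor n + 1 is absorbed by passing from A to A + 1, and the four extra powers of t by
   passing from B to B + 4; doing so twice gives [XSS]. *)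
have XS n : n.+1%:R * X n.+1 * Beta B (c - B) =
    A * (binom_coef (A + 1) n * Beta (B + 4 + (4 * n)%:R) (s + 1 + (A + 1))).
  rewrite -mulrA XB mulrA binom_coefS -mulrA mulnS natrD [B + (_ + _)]addrA.
  by rewrite (_ : s + 1 + (A + 1) = c - B)// /s; ring.
have XSS n : n.+2%:R * n.+1%:R * X n.+2 * Beta B (c - B) =
    A * ((A + 1) * (binom_coef (A + 2) n * Beta (B + 8 + (4 * n)%:R) (s + (A + 2)))).
  have e1 := binom_coefS A n.+1; have e2 := binom_coefS (A + 1) n.
  rewrite -addrA -[1 + 1]/(2 : R) in e2.
  rewrite -mulrA XB (_ : s + (A + 2) = c - B); last by rewrite /s; ring.
  rewrite (_ : B + 8 + (4 * n)%:R = B + (4 * n.+2)%:R); last first.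
    by rewrite !mulnSr !natrD; ring.
  have aux (x y u v : R) : x * y * (u * v) = x * u * y * v by ring.
  by rewrite aux e1 -[A * _ * _]mulrA [binom_coef _ _ * _]mulrC e2 -!mulrA.
have H2 M : \sum_(n < M.+1) n%:R * X n * Beta B (c - B) <= A * (Gamma (s + 1) * L2).
  have E : B + 4 + (s + 1) = c - A + 3 by rewrite /s; ring.
  have := @sum_Beta_le_gamma_series R (A + 1) (B + 4) (s + 1) M.
  rewrite E => /(_ (ltW (addr_gt0 A0 ltr01)) (addr_gt0 B0 (ltr0n _ 4)) (addr_gt0 s0 ltr01) c2) H.
  apply: le_trans (ler_wpM2l (ltW A0) H).
  rewrite big_ord_recl !mul0r add0r mulr_sumr.
  rewrite le_eqVlt; apply/orP; left; apply/eqP; apply: eq_bigr => n _.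
  exact: XS.
have H1 M : \sum_(n < M.+2) n%:R * (n%:R - 1) * X n * Beta B (c - B) <=
    A * ((A + 1) * (Gamma s * L1)).
  have E : B + 8 + s = c - A + 6 by rewrite /s; ring.
  have := @sum_Beta_le_gamma_series R (A + 2) (B + 8) s M.
  rewrite E => /(_ (ltW (addr_gt0 A0 (ltr0n _ 2))) (addr_gt0 B0 (ltr0n _ 8)) s0 c1) H.
  have A1 : 0 < A + 1 by rewrite addr_gt0.
  apply: le_trans (ler_wpM2l (ltW A0) (ler_wpM2l (ltW A1) H)).
  rewrite !big_ord_recl !mul0r add0r -[(lift ord0 ord0 : nat)]/1%N subrr mulr0 !mul0r add0r.
  rewrite !mulr_sumr.
  rewrite le_eqVlt; apply/orP; left; apply/eqP; apply: eq_bigr => n _.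
  rewrite -XSS -[(lift ord0 (lift ord0 n) : nat)]/n.+2.
  by rewrite (_ : n.+2%:R - 1 = n.+1%:R)// -[n.+2%:R]natr1 addrK.
rewrite -(ler_pM2r BT0) mulr_suml.
(* Two more nonnegative terms are added because n = 0 and n = 1 drop out of the n (n - 1) part,
   leaving exactly N shifted terms there. *)
apply: (@le_trans _ _ (\sum_(n < N.+2) (n%:R + 1) * (n%:R + lam) * X n * Beta B (c - B))).
  rewrite !big_ord_recr/= -addrA lerDl addr_ge0//.
    by rewrite mulr_ge0 ?(ltW BT0)// mulr_ge0// mulr_ge0// addr_ge0// ltW.
  by rewrite mulr_ge0 ?(ltW BT0)// mulr_ge0// mulr_ge0// addr_ge0// ltW.
rewrite (eq_bigr (fun n : 'I_N.+2 => n%:R * (n%:R - 1) * X n * Beta B (c - B) +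
   (lam + 2) * (n%:R * X n * Beta B (c - B)) + lam * (X n * Beta B (c - B)))); last first.
  by move=> n _; ring.
rewrite !big_split/= -!mulr_sumr.
apply: (le_trans (lerD (lerD (H1 N) (ler_wpM2l l2 (H2 N.+1))) (ler_wpM2l (ltW l0) (H3 N.+2)))).
rewrite -ler_pdivrMr//; apply: le_trans ineq.
(* Gamma(c - A - B) = (s + 1) s Gamma(s), which accounts for the denominators (c - A - B - 2)_2 = s
   (s + 1) and c - A - B - 1 = s + 1 of the hypothesis. *)
have G2 : Gamma (s + 2) = (s + 1) * Gamma (s + 1).
  have -> : s + 2 = 1 + (s + 1) by ring.
  by apply: GammaS; exact: addr_gt0.
have G1 : Gamma (s + 1) = s * Gamma s by rewrite [s + 1]addrC; exact: GammaS.
have -> : c - A - B = s + 2 by rewrite /s; ring.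
rewrite !pochhammerSr !pochhammer0 !addr0 !mul1r.
rewrite (_ : s + 2 - 2 = s); last by ring.
rewrite (_ : s + 2 - 1 = s + 1); last by ring.
rewrite G2 G1 /Beta (addrC B) subrK.
have g1 := Gamma_gt0 B0; have g2 := Gamma_gt0 cB0; have g3 := Gamma_gt0 c0.
have s10 : 0 < s + 1 by rewrite addr_gt0.
move: (Gamma B) (Gamma (c - B)) (Gamma c) (Gamma s) g1 g2 g3.
move=> gb gcb gc gs g1 g2 g3.
rewrite le_eqVlt; apply/orP; left; apply/eqP; field.
by rewrite !gt_eqF.
Qed.

End QuarticParameters.

Theorem theorem3p22 (R : realType) (a b : cplx R) (c lam : R)
  (a_neq0 : a != 0) (b_neq0 : b != 0) (c_gt0 : 0 < c)
  (c_large : cabs a + cabs b + 2 < c)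
  (lam_gt0 : 0 < lam) (lam_le1 : lam <= 1) :
  let A := cabs a in
  let B := cabs b in
  let T1 (n : nat) : R :=
    gbinom (- (A + 2)) n
    * (Gamma (B + 8 + 2 * n%:R) / Gamma (c - A + 6 + 2 * n%:R))
    * hyp2F1_real (A + 2) (B + 8 + 2 * n%:R) (c - A + 6 + 2 * n%:R) (-1) in
  let T2 (n : nat) : R :=
    gbinom (- (A + 1)) n
    * (Gamma (B + 4 + 2 * n%:R) / Gamma (c - A + 3 + 2 * n%:R))
    * hyp2F1_real (A + 1) (B + 4 + 2 * n%:R) (c - A + 3 + 2 * n%:R) (-1) in
  let T3 (n : nat) : R :=
    gbinom (- A) n
    * (Gamma (B + 2 * n%:R) / Gamma (c - A + 2 * n%:R))
    * hyp2F1_real A (B + 2 * n%:R) (c - A + 2 * n%:R) (-1) in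
  cvgn (series T1) -> cvgn (series T2) -> cvgn (series T3) ->
  Gamma c * Gamma (c - A - B) / (Gamma B * Gamma (c - B))
  * (pochhammer A 2 / pochhammer (c - A - B - 2) 2 * limn (series T1)
     + (lam + 2) * A / (c - A - B - 1) * limn (series T2)
     + lam * limn (series T3))
  <= 2 * lam ->
  classC lam (fun z : cplx R =>
    z * hyp5F4 a (b / 4) ((b + 1) / 4) ((b + 2) / 4) ((b + 3) / 4)
          (of_real c / 4) ((of_real c + 1) / 4) ((of_real c + 2) / 4)
          ((of_real c + 3) / 4) z).
Proof.
move=> A B T1 T2 T3 c1 c2 c3 ineq.
have A0 : 0 < A by rewrite cabs_gt0.
have B0 : 0 < B by rewrite cabs_gt0.
have wsum N := @weighted_sum_le R A B c lam N A0 B0 c_large lam_gt0 c1 c2 c3 ineq.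
pose al := hyp5F4_coef a b (of_real c).
pose X n := binom_coef A n * (pochhammer B (4 * n) / pochhammer c (4 * n)).
have alX n : cabs (al n) <= X n by exact: cabs_hyp5F4_coef_le.
have al_sum N : \sum_(n < N) (n%:R + 1) * (n%:R + lam) * cabs (al n) <= 2 * lam.
  apply: le_trans (wsum N); apply: ler_sum => n _; rewrite ler_wpM2l//.
  by rewrite mulr_ge0// addr_ge0// ltW.
(* The factor z in front of the 5F4 shifts indices by one, so n (n + lam - 1) at index n + 1 is the
   weight (n + 1) (n + lam). *)
pose aa n := if n is m.+1 then al m else 0.
have al0 : al 0%N = 1.
  by rewrite /al /hyp5F4_coef muln0 !pochhammer0 fact0 !mulr1 divr1.
apply: (@classC_coef R aa lam _ lam_gt0) => //.
- move=> z zd.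
  rewrite (_ : series _ = (fun N =>
    if N is M.+1 then z * series (fun n => al n * z ^+ n) M else 0)); last first.
    apply/funext => -[|N]; first by rewrite /series/= big_geq.
    rewrite /series/= !big_mkord big_ord_recl/= mul0r add0r mulr_sumr.
    by apply: eq_bigr => n _; rewrite exprS mulrCA.
  rewrite -cvg_shiftS.
  (* Since (n + 1) (n + lam) >= lam, the sums of |al n| are at most 2, which gives convergence on
     the disc. *)
  have [|l Hl] := @abs_series_cvg R (fun n => al n * z ^+ n) 2.
    move=> N; rewrite -(ler_pM2l lam_gt0) mulr_sumr [lam * 2]mulrC.
    apply: le_trans (al_sum N); apply: ler_sum => n _.
    apply: ler_pM; rewrite ?cabs_ge0 ?(ltW lam_gt0)//.
      rewrite -[leLHS]mul1r ler_pM ?(ltW lam_gt0)// ?lerDr ?lerDl//.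
    rewrite cabsMX ler_piMr ?cabs_ge0// exprn_ile1 ?cabs_ge0// ltW//.
    exact/unit_discE.
  have Hz : series (fun n => al n * z ^+ n) @ \oo -->
        hyp5F4 a (b / 4) ((b + 1) / 4) ((b + 2) / 4) ((b + 3) / 4)
          (of_real c / 4) ((of_real c + 1) / 4) ((of_real c + 2) / 4)
          ((of_real c + 3) / 4) z.
    rewrite /hyp5F4 (funext (hyp5F4_term a b (of_real c) z)).
    by apply/cvg_ex; exists l.
  by apply: cvgM; [exact: cvg_cst|exact: Hz].
case=> [|N]; first by rewrite big_ord0 mulr_ge0// ltW.
rewrite big_ord_recl/= !mul0r add0r; apply: le_trans (al_sum N).
rewrite le_eqVlt; apply/orP; left; apply/eqP; apply: eq_bigr => n _.
by rewrite /= -[bump 0 n]/n.+1 -natr1; congr (_ * _ * _); ring.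
Qed.
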